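(* Let $T_{\text{FJ-GA},\lambda}$, $T_{\text{FJ-FA},\lambda}$ and $T_{\text{FJ-SM},\lambda}$ denote the steady-state download times in the FJ-GA, FJ-FA and FJ-SM systems (defined in the context) with aggregate Poisson arrival rate $\lambda$, all built on the same storage system with an $(r,t)$-availability code and i.i.d. $\mathrm{Exp}(\mu)$ service times, where in FJ-GA each request asks for object $f_i$ with probability $p_i$. Then for all $x \ge 0$: $$\Pr\{T_{\text{FJ-GA},\lambda} > x\} \ge \sum_{i=1}^k p_i \Pr\{T_{\text{FJ-FA},\lambda p_i} > x\} \ge \sum_{i=1}^k p_i \exp\!\big(-((t+1)\mu - p_i\lambda)x\big),$$ $$\Pr\{T_{\text{FJ-GA},\lambda} > x\} \le \Pr\{T_{\text{FJ-SM},\lambda} > x\}, \qquad \Pr\{T_{\text{FJ-FA},\lambda} > x\} \le \Pr\{T_{\text{FJ-SM},\lambda} > x\}.$$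
   Context: Storage model: $k$ objects $f_1,\dots,f_k$ are encoded by a systematic $(n,k)$ linear code and stored on $n$ servers, one symbol per server, with $(r,t)$-availability: for each systematic server $i$ (storing $f_i$) there are $t$ pairwise disjoint recovery groups, each a set of $r$ servers not containing server $i$, from any one of which $f_i$ can be recovered. Requests arrive as a Poisson process of rate $\lambda$. Fork-Join (FJ) access: a request for $f_i$ is replicated upon arrival into $t+1$ copies, one to systematic server $i$ and one to each of its $t$ recovery groups; a copy at a recovery group is forked into $r$ sub-copies, one per server of the group, and completes when all $r$ sub-copies finish. The request completes when its systematic copy finishes or some recovery-group copy completes; then all its outstanding copies/sub-copies (queued or in service) are removed immediately. Each server has a FCFS queue and serves one sub-copy at a time; service times are independent across servers and copies, each $\mathrm{Exp}(\mu)$. Download time is departure time minus arrival time. FJ-GA: each request independently asks for $f_i$ with probability $p_i$ ($\sum_i p_i = 1$). FJ-FA: every request asks for the same object. FJ-SM: requests wait in a centralized FCFS queue and the request at its head is admitted to the servers (and then served as in the FJ scheme) only when all servers are idle. All systems are assumed stable, so that steady-state download times exist. *)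

(* Defs.v *)
From HB Require Import structures.
From mathcomp Require Import all_boot all_order all_algebra.
From mathcomp Require Import all_classical all_reals all_analysis.

Set Implicit Arguments.
Unset Strict Implicit.
Unset Printing Implicit Defensive.

Import Order.TTheory GRing.Theory Num.Theory.
Import numFieldNormedType.Exports.
Local Open Scope classical_set_scope.
Local Open Scope ring_scope.

(* Storage system: n servers, k objects, systematic server [sys i] storing   *)
(* f_i, and t recovery groups [rec i g] (g < t) for each object i.           *)
(* The (n,k) linear code is given by a generator matrix G : 'M[F]_(k,n);     *)
(* server s stores the symbol f *m col s G, i.e. the row vector row s G^T.   *)

(* f_i can be recovered from the symbols stored on the servers in A:        *)
(* the i-th unit row vector lies in the span of the coding vectors of A.    *)
Definition recoverable (F : fieldType) (k n : nat) (G : 'M[F]_(k, n))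
    (i : 'I_k) (A : {set 'I_n}) : bool :=
  ((delta_mx 0 i : 'rV[F]_k) <= \sum_(s in A) <<row s G^T>>)%MS.

Definition rt_availability (F : fieldType) (k n r t : nat) (G : 'M[F]_(k, n))
    (sys : 'I_k -> 'I_n) (rec : 'I_k -> 'I_t -> {set 'I_n}) : Prop :=
  injective sys /\
  [/\ (forall i : 'I_k, row (sys i) G^T = (delta_mx 0 i : 'rV[F]_k)),
      (forall i g, #|rec i g| = r),
      (forall i g, sys i \notin rec i g),
      (forall i (g g' : 'I_t), g != g' -> forall s, s \in rec i g -> s \notin rec i g')
    & (forall i g, recoverable G i (rec i g))].

Section Dynamics.
Variables (R : realType) (k n t : nat).
Variables (sys : 'I_k -> 'I_n) (rec : 'I_k -> 'I_t -> {set 'I_n}).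

Definition fj_servers (i : 'I_k) : {set 'I_n} :=
  sys i |: \bigcup_(g < t) rec i g.

(* Departure time of a request for f_i arriving at time a, when server s    *)
(* becomes free (of all earlier work) at time F s, and its sub-copy at s     *)
(* needs service S s.  The sub-copy at s starts at max a (F s) (FCFS) and    *)
(* would finish at max a (F s) + S s; the request departs at the first of:   *)
(* the systematic copy finishing, or all sub-copies of some group finishing. *)
Definition fj_depart (Ffree : 'I_n -> R) (a : R) (i : 'I_k) (S : 'I_n -> R) : R :=
  let fin s := Num.max a (Ffree s) + S s in
  \big[Num.min/fin (sys i)]_(g < t) \big[Num.max/a]_(s in rec i g) fin s.

(* Free times after serving this request: at a server s used by it, the     *)
(* sub-copy occupies s until it finishes or is removed at the departure.    *)
Definition fj_free_step (Ffree : 'I_n -> R) (a : R) (i : 'I_k) (S : 'I_n -> R)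
  : 'I_n -> R := fun s =>
  if s \in fj_servers i then
    Num.max (Ffree s) (Num.min (Num.max a (Ffree s) + S s) (fj_depart Ffree a i S))
  else Ffree s.

Definition arrival (A : nat -> R) (m : nat) : R := \sum_(j < m.+1) A j.

(* free times of the servers just before request m arrives (all idle at 0) *)
Fixpoint fj_free (A : nat -> R) (O : nat -> 'I_k) (S : nat -> 'I_n -> R)
    (m : nat) : 'I_n -> R :=
  match m with
  | 0 => fun _ => 0
  | m'.+1 => fj_free_step (fj_free A O S m') (arrival A m') (O m') (S m')
  end.

Definition fj_download (A : nat -> R) (O : nat -> 'I_k) (S : nat -> 'I_n -> R)
    (m : nat) : R :=
  fj_depart (fj_free A O S m) (arrival A m) (O m) (S m) - arrival A m.

(* FJ-SM: request m is admitted at max (arrival) (previous departure), on   *)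
(* idle servers, and then departs after the FJ service of an idle system.  *)
Fixpoint sm_depart (A : nat -> R) (O : nat -> 'I_k) (S : nat -> 'I_n -> R)
    (m : nat) : R :=
  let prev := if m is m'.+1 then sm_depart A O S m' else 0 in
  let b := Num.max (arrival A m) prev in
  fj_depart (fun _ => b) b (O m) (S m).

Definition sm_download (A : nat -> R) (O : nat -> 'I_k) (S : nat -> 'I_n -> R)
    (m : nat) : R :=
  sm_depart A O S m - arrival A m.

End Dynamics.

(* Stochastic input: a probability space carrying interarrival times A m,   *)
(* requested objects O m and service times S m s (sub-copy of request m at  *)
(* server s).                                                                *)
Record fj_input (R : realType) (k n : nat) := FJInput {
  fji_d : measure_display;
  fji_T : measurableType fji_d;
  fji_P : probability fji_T R;
  fji_A : nat -> fji_T -> R;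
  fji_O : nat -> fji_T -> 'I_k;
  fji_S : nat -> 'I_n -> fji_T -> R }.

(* index of the elementary random elements: inl (inl m) = interarrival    *)
(* time A m, inl (inr m) = object O m, inr (m, s) = service time S m s     *)
Definition fj_index (n : nat) : eqType := (nat + nat + nat * 'I_n)%type.

Arguments fji_d {R k n}.
Arguments fji_T {R k n}.
Arguments fji_P {R k n}.
Arguments fji_A {R k n}.
Arguments fji_O {R k n}.
Arguments fji_S {R k n}.

Definition mutually_independent (R : realType) (d : measure_display)
    (T : measurableType d) (P : probability T R) (I : eqType)
    (C : I -> set (set T)) : Prop :=
  forall (s : seq I) (E : I -> set T), uniq s ->
    (forall i, i \in s -> C i (E i)) ->
    P (\big[setI/setT]_(i <- s) E i) = \big[*%E/1%E]_(i <- s) P (E i).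

Section Model.
Variables (R : realType) (k n : nat) (M : fj_input R k n).
Local Notation P := (fji_P M).
Local Notation A := (fji_A M).
Local Notation O := (fji_O M).
Local Notation S := (fji_S M).

Definition fj_events (x : fj_index n) : set (set (fji_T M)) :=
  match x with
  | inl (inl m) => [set A m @^-1` B | B in [set B : set R | measurable B]]
  | inl (inr m) => [set O m @^-1` B | B in [set: set 'I_k]]
  | inr (m, s) => [set S m s @^-1` B | B in [set B : set R | measurable B]]
  end.

Definition exp_tail (rate : R) (X : fji_T M -> R) : Prop :=
  forall x : R, 0 <= x -> P [set w | x < X w] = (expR (- (rate * x)))%:E.

Definition fj_base (lam mu : R) : Prop :=
  (forall m, measurable_fun setT (A m)) /\
  [/\
      (forall m (B : set 'I_k), measurable (O m @^-1` B)),
      (forall m s, measurable_fun setT (S m s)),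
      mutually_independent P fj_events,
      (forall m, exp_tail lam (A m))
    & (forall m s, exp_tail mu (S m s))].

Definition GA_input (lam mu : R) (p : 'I_k -> R) : Prop :=
  fj_base lam mu /\ forall m i, P [set w | O m w = i] = (p i)%:E.

Definition FA_input (lam mu : R) (j : 'I_k) : Prop :=
  fj_base lam mu /\ forall m w, O m w = j.

(* L is the steady-state tail function of the download times T m:          *)
(* Pr{T_m > x} -> L x as m -> oo, for every x, and the limit law is proper  *)
(* (L x -> 0 as x -> +oo), i.e. the system is stable.                      *)
Definition steady_tail (T : nat -> fji_T M -> R) (L : R -> R) : Prop :=
  (forall x : R, (fun m => fine (P [set w | x < T m w])) @ \oo --> L x) /\
  (L x @[x --> +oo] --> (0 : R)).

End Model.

Definition T_FJ (R : realType) (k n t : nat) (sys : 'I_k -> 'I_n)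
    (rec : 'I_k -> 'I_t -> {set 'I_n}) (M : fj_input R k n) :
    nat -> fji_T M -> R :=
  fun m w => fj_download sys rec (fun j => fji_A M j w) (fun j => fji_O M j w)
                         (fun j s => fji_S M j s w) m.

Definition T_SM (R : realType) (k n t : nat) (sys : 'I_k -> 'I_n)
    (rec : 'I_k -> 'I_t -> {set 'I_n}) (M : fj_input R k n) :
    nat -> fji_T M -> R :=
  fun m w => sm_download sys rec (fun j => fji_A M j w) (fun j => fji_O M j w)
                         (fun j s => fji_S M j s w) m.

Arguments T_FJ {R k n t} sys rec M _ _.
Arguments T_SM {R k n t} sys rec M _ _.

(* Main.v *)
Require Import Defs.
From HB Require Import structures.
From mathcomp Require Import all_boot all_order all_algebra.
From mathcomp Require Import all_classical all_reals all_analysis.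
From mathcomp Require Import measurable_realfun ring lra.
Import Order.TTheory GRing.Theory Num.Theory.
Import numFieldNormedType.Exports.
Set Implicit Arguments.
Unset Strict Implicit.
Unset Printing Implicit Defensive.
Local Open Scope classical_set_scope.
Local Open Scope ring_scope.

(* The state of the servers seen by a request is the vector of their residual
   workloads; departures and workloads are nondecreasing in it.

   Upper bounds: sample path by sample path, fork-join is faster than
   split-merge.  The split-merge download time follows the Lindley recursion
   L' = max(0, L - A) + D, where the law of the duration D does not depend on the
   requested object: all objects use one systematic server and t disjoint groups
   of r servers.  So split-merge has the same law for every popularity vector.

   Exponential lower bound: keeping one server in each recovery group, the
   fixed-object system dominates a single-server queue with Exp((t+1) mu)
   services, whose sojourn time has the limiting tail exp(-((t+1) mu - lam) x).
   When lam >= (t+1) mu the same bound with arbitrarily small rates th > 0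
   contradicts the properness of the limit law.

   Lower bound of the general system: dropping the requests for other objects
   decreases the workloads.  If X_m is the workload of the thinned system after
   m arrivals of rate lam and Y_K that of the fixed-object system of rate lam p
   after K arrivals, then
     E phi(X_{m+1}) = p E JD phi(X_m) + (1-p) E D phi(X_m),
     E phi(Y_{K+1}) = p E JD phi(Y_K) + (1-p) E D phi(Y_{K+1}),
   where D averages over an Exp(lam) idle period and J over one service; the
   second line holds because Exp(lam p) is a geometric sum of Exp(lam) variables.
   By induction E phi(Y_K) - E phi(X_m) <= 2^K (1 - p/2)^m for phi monotone with
   values in [0,1]. *)

(** * Laws and independence *)

(** The distribution of [X], packed from a bare proof of measurability so that random variables can
    stay plain functions. *)
Definition law (d d' : measure_display) (T : measurableType d)
    (V : measurableType d') (R : realType) (P : probability T R) (X : T -> V)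
    (mX : measurable_fun setT X) : probability V R :=
  distribution P (HB.pack_for {mfun T >-> V} X (isMeasurableFun.Build _ _ _ _ X mX)).

Section Law.
Context (d d' : measure_display) (T : measurableType d)
  (V : measurableType d') (R : realType) (P : probability T R) (X : T -> V)
  (mX : measurable_fun setT X).

Lemma lawE B : law P mX B = P (X @^-1` B).
Proof. by []. Qed.

Lemma ge0_integral_law (f : V -> \bar R) : measurable_fun setT f ->
  (forall y, 0 <= f y)%E -> (\int[law P mX]_y f y = \int[P]_w f (X w))%E.
Proof. by move=> mf f0; rewrite /law ge0_integral_distribution. Qed.

End Law.

Section IndepIntegral.
Context (d d1 d2 : measure_display) (T : measurableType d)
  (U : measurableType d1) (V : measurableType d2) (R : realType).
Variables (P : probability T R) (X : T -> U) (Y : T -> V) (H : set T).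
Hypotheses (mX : measurable_fun setT X) (mY : measurable_fun setT Y)
  (mH : measurable H).
Variables (al : probability U R) (be : probability V R) (c : {nonneg R}).
Hypothesis rect : forall E F, measurable E -> measurable F ->
  P (H `&` (X @^-1` E `&` Y @^-1` F)) = (c%:num%:E * (al E * be F))%E.

(** By [rect], the image under [(X, Y)] of [P] restricted to [H] agrees on rectangles with [c] times
    the product of [al] and [be], hence everywhere; Tonelli does the rest. Later [H] is an event on
    the requested object and [c] its probability. *)
Lemma indep_integral_on (f : U * V -> \bar R) : measurable_fun setT f ->
  (forall z, 0 <= f z)%E ->
  (\int[P]_(w in H) f (X w, Y w) =
   c%:num%:E * \int[al]_x \int[be]_y f (x, y))%E.
Proof.
move=> mf f0.
have mXY : measurable_fun setT (fun w => (X w, Y w)) by exact: measurable_fun_pair.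
have mfXY : measurable_fun setT (fun w => f (X w, Y w)).
  exact: (measurableT_comp mf mXY).
pose PH := [the measure _ _ of mrestr P mH].
have -> : (\int[P]_(w in H) f (X w, Y w) = \int[PH]_w f (X w, Y w))%E.
  rewrite -(setvU H) setUC ge0_integral_setU//=; last 3 first.
  - exact: measurableC.
  - by rewrite setUv.
  - by rewrite disj_set2E setICr.
  rewrite [X in (_ + X)%E](_ : _ = 0%E); last first.
    apply: null_set_integral => //.
    - exact: measurableC.
    - by apply: measurable_funTS.
    - by rewrite /PH/= /mrestr setICl measure0.
  rewrite adde0; apply: eq_measure_integral => A mA AH.
  by rewrite /PH/= /mrestr setIidl.
rewrite -(ge0_integral_pushforward mXY PH measurableT mf); last by move=> z _; exact: f0.
pose mc := [the {finite_measure set U -> \bar R} of mscale c al].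
pose m' := measure_function_pushforward__canonical__measure_function_Measure PH mXY.
have E := @product_measure_unique _ _ _ _ R mc be m' _.
rewrite (eq_measure_integral (m1 := m') [the measure _ _ of (mc \x be)%E]); last first.
  move=> A mA _; apply/esym/E => // B C mB mC.
  rewrite /m'/= /pushforward/= /mrestr/= setIC.
  have := rect mB mC; rewrite /preimage /= /mscale/= muleA => <-.
  by congr (P _); apply/seteqP; split => w /=; tauto.
rewrite fubini_tonelli1//= ge0_integral_mscale//.
- exact: measurable_fun_fubini_tonelli_F.
- by move=> x _; apply: integral_ge0 => y _; exact: f0.
Qed.

End IndepIntegral.

Section RayUnique.
Context (R : realType).
Implicit Types m : {measure set R -> \bar R}.

(** Open right rays are closed under intersection, generate the Borel sets and exhaust the line. *)
Lemma ray_unique m1 m2 : (m1 setT < +oo)%E ->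
  (forall x : R, m1 `]x, +oo[%classic = m2 `]x, +oo[%classic) ->
  forall B, measurable B -> m1 B = m2 B.
Proof.
move=> m1T m12 B mB.
refine (@measure_unique _ R R (@RGenOInfty.G R)
  (fun k => `](- k%:R)%R, +oo[%classic) _ _ _ _ m1 m2 _ _ B mB).
- exact: RGenOInfty.measurableE.
- move=> _ _ [x ->] [y ->]; exists (Num.max x y).
  apply/seteqP; split => z /=; rewrite !in_itv/= !andbT gt_max; first by case=> -> ->.
  by move=> /andP.
- by move=> i; exists (- i%:R).
- rewrite predeqE => x; split => // _; exists (Num.bound (`|x|)) => //=.
  rewrite in_itv/= andbT ltrNl; apply: le_lt_trans (archi_boundP (normr_ge0 x)).
  by rewrite -normrN ler_norm.
- by move=> _ [x ->]; exact: m12.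
- move=> k; apply: le_lt_trans m1T; apply: le_measure; rewrite ?inE//.
Qed.

End RayUnique.

(** * Exponential distributions *)

Section ExpLaw.
Context (R : realType).
Notation leb := (@lebesgue_measure R).
Implicit Types m : probability R R.

Definition exp_prob (rate : R) (h : 0 < rate) : probability (measurableTypeR R) R :=
  exponential_distribution_exponential_prob__canonical__probability_measure_Probability h.

Let idR : measurableTypeR R -> R := id.
Let measurable_idR : measurable_fun setT idR.
Proof. by move=> _ B mB; rewrite setTI. Qed.

(* [lebesgue_measure] lives on [measurableTypeR R], whose display is not the
   one of the canonical instance on [R]. *)
Definition exp_dist (rate : R) (h : 0 < rate) : probability R R :=
  law (exp_prob h) measurable_idR.

(** Only nonnegative [x] are constrained, as in [exp_tail]. This determines the law: at [x = 0] it
    already puts mass 1 on []0, +oo[]. *)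
Definition is_exp m (rate : R) :=
  forall x : R, 0 <= x -> m `]x, +oo[%classic = (expR (- (rate * x)))%:E.

Lemma exp_dist_itv0c (rate : R) (h : 0 < rate) (x : R) : 0 <= x ->
  exp_dist h `[0, x]%classic = (1 - expR (- (rate * x)))%:E.
Proof.
rewrite le_eqVlt => /predU1P[<-|x0].
  rewrite mulr0 oppr0 expR0 subrr set_itv1 /exp_dist /= /exponential_prob.
  by rewrite integral_set1.
by rewrite /exp_dist/= exponential_prob_itv0c// mulNr EFinB.
Qed.

Lemma exp_dist_lt0 (rate : R) (h : 0 < rate) : exp_dist h `]-oo, 0[%classic = 0%E.
Proof.
rewrite /exp_dist /= /exponential_prob; apply: integral0_eq => x /=.
by rewrite in_itv/= => x0; rewrite lt0_exponential_pdf.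
Qed.

Lemma exp_dist_ray (rate : R) (h : 0 < rate) : is_exp (exp_dist h) rate.
Proof.
move=> x x0.
have -> : `]x, +oo[%classic = ~` (`]-oo, 0[ `|` `[0, x])%classic :> set R.
  apply/seteqP; split => z /=; rewrite !in_itv/= ?andbT.
    by move=> xz [|/andP[_]]; [move=> /(lt_trans xz)/lt_geF; rewrite x0|move=> /(lt_le_trans xz); rewrite ltxx].
  by move=> /not_orP[/negP]; rewrite -leNgt => z0 /negP; rewrite z0/= -ltNge.
rewrite probability_setC; last exact: measurableU.
rewrite measureU//; last first.
  rewrite -subset0 => z /= []; rewrite !in_itv/= => z0 /andP[].
  by rewrite leNgt z0.
rewrite [X in (_ - (X + _))%E]exp_dist_lt0 add0e.
rewrite [X in (_ - X)%E](exp_dist_itv0c h x0) -EFinB; congr EFin; ring.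
Qed.

Lemma is_exp_lt0 m rate : is_exp m rate -> m `]-oo, 0[%classic = 0%E.
Proof.
move=> me; have := me 0 (lexx _); rewrite mulr0 oppr0 expR0 => m0.
apply/eqP; rewrite eq_le measure_ge0// andbT.
rewrite (_ : 0%E = m (~` `]0, +oo[%classic)); last first.
  by rewrite probability_setC// m0 subee.
apply: le_measure; rewrite ?inE//; first exact: measurableC.
by move=> z /=; rewrite !in_itv/= andbT => z0; apply/negP; rewrite -leNgt ltW.
Qed.

Lemma is_exp_ae m rate : is_exp m rate -> {ae m, forall a : R, 0 <= a}.
Proof.
move=> /is_exp_lt0 m0; exists `]-oo, 0[%classic; split => //.
by move=> a /=; rewrite in_itv/= => /negP; rewrite -ltNge.
Qed.

Lemma is_exp_neg m rate (x : R) : is_exp m rate -> x < 0 -> m `]x, +oo[%classic = 1%E.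
Proof.
move=> me x0; apply/eqP; rewrite eq_le probability_le1//=.
rewrite -[X in (X <= _)%E](_ : m `]0, +oo[%classic = _); last first.
  by rewrite me// mulr0 oppr0 expR0.
apply: le_measure; rewrite ?inE//.
by move=> z /=; rewrite !in_itv/= !andbT; exact: lt_trans.
Qed.

Lemma is_exp_unique m1 m2 rate : is_exp m1 rate -> is_exp m2 rate ->
  forall B, measurable B -> m1 B = m2 B.
Proof.
move=> h1 h2; apply: ray_unique; first by rewrite [X in (X < _)%E](@probability_setT _ _ _ m1) ltry.
move=> x; have [x0|x0] := ltP x 0; first by rewrite [LHS](is_exp_neg h1 x0) [RHS](is_exp_neg h2 x0).
by rewrite [LHS](h1 _ x0) [RHS](h2 _ x0).
Qed.

Lemma exp_dist_dom (rate : R) (h : 0 < rate) : exp_prob h `<< leb.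
Proof.
apply/null_content_dominatesP => A mA A0; apply: null_set_integral => //.
apply: measurable_funTS; apply/measurable_EFinP.
exact: measurable_exponential_pdf.
Qed.

(** The Radon-Nikodym derivative of [exp_prob h] and [exponential_pdf] have the same integrals on
    measurable sets, so they agree almost everywhere. *)
Lemma exp_prob_integral (rate : R) (h : 0 < rate) (f : measurableTypeR R -> \bar R) U :
  measurable U -> (exp_prob h).-integrable U f ->
  (\int[exp_prob h]_(x in U) f x =
   \int[leb]_(x in U) (f x * (exponential_pdf rate x)%:E))%E.
Proof.
move=> mU fi; have mf := measurable_int _ fi.
have mpdf : measurable_fun U (fun x => (exponential_pdf rate x)%:E).
  by apply: measurable_funTS; apply/measurable_EFinP; exact: measurable_exponential_pdf.
rewrite -(Radon_Nikodym_change_of_variables (exp_dist_dom h))//=.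
apply: ae_eq_integral => //.
- apply: emeasurable_funM => //; apply: (measurable_int leb).
  apply: (integrableS _ _ (@subsetT _ _)) => //=.
  by apply: Radon_Nikodym_integrable; exact: exp_dist_dom.
- exact: emeasurable_funM.
- apply: ae_eqe_mul2l => /=.
  rewrite Radon_NikodymE//=; first exact: exp_dist_dom.
  move=> abmu; case: cid => /= g [g1 g2 g3].
  apply: integral_ae_eq => //=.
  + exact: integrableS g2.
  + by move=> E EU mE; rewrite -g3.
Qed.

(** Exponential tilting: [expR (c * v)] times the density of rate [rate] is [rate / (rate - c)]
    times the density of rate [rate - c]. The bound [K] gives integrability; it covers both a
    negative [c] on the half-line and any [c] on a bounded interval. *)
Lemma exp_tilt m (rate c : R) (B : set R) : 0 < rate -> c < rate -> is_exp m rate ->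
  measurable B -> B `<=` `[0, +oo[%classic ->
  (exists K, forall v, B v -> expR (c * v) <= K) ->
  (\int[m]_(v in B) (expR (c * v))%:E = (rate / (rate - c))%:E *
     exponential_prob (rate - c) B)%E.
Proof.
move=> rate0 crate me mB B0 [K BK].
have mexp : measurable_fun setT (fun v : R => expR (c * v)).
  by apply: measurableT_comp => //; exact: measurable_funM.
have rc0 : 0 < rate - c by rewrite subr_gt0.
rewrite (eq_measure_integral (exp_dist rate0)); last first.
  by move=> A mA _; apply: (is_exp_unique me) => //; exact: exp_dist_ray.
rewrite integral_mkcond ge0_integral_law//=; last 2 first.
- apply/(measurable_restrictT _ _).1 => //.
  by apply: measurable_funTS; exact/measurable_EFinP.
- by move=> y; apply: erestrict_ge0 => z _; rewrite lee_fin expR_ge0.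
rewrite /idR -integral_mkcond (exp_prob_integral (h := rate0))//; last first.
  apply: measurable_bounded_integrable => //.
  - by apply: (@le_lt_trans _ _ 1%E); [exact: probability_le1|exact: ltry].
  - exact: measurable_funTS.
  - exists K; split; first exact: num_real.
    by move=> x Kx v /= Bv; rewrite ger0_norm ?expR_ge0//; exact: le_trans (BK _ Bv) (ltW Kx).
rewrite /exponential_prob -ge0_integralZl//; last 3 first.
- apply: measurable_funTS; apply/measurable_EFinP; exact: measurable_exponential_pdf.
- by move=> x _; rewrite lee_fin exponential_pdf_ge0// ltW.
- by rewrite lee_fin divr_ge0// ltW.
apply: eq_integral => v; rewrite inE => Bv.
have v0 : 0 <= v by have := B0 _ Bv; rewrite /= in_itv/= andbT.
rewrite -!EFinM !exponential_pdfE//; congr EFin.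
rewrite [RHS]mulrA divfK ?gt_eqF// mulrCA -expRD; congr (_ * expR _); ring.
Qed.

Lemma exp_laplace m (rate th : R) : 0 < rate -> 0 < th -> is_exp m rate ->
  (\int[m]_(v in `[0%R, +oo[) (expR (- (th * v)))%:E = (rate / (rate + th))%:E)%E.
Proof.
move=> r0 t0 me.
under eq_integral do rewrite -mulNr.
have rt : 0 < rate - - th by rewrite opprK addr_gt0.
rewrite (@exp_tilt _ rate (- th))//; first last.
- exists 1 => v /=; rewrite in_itv/= andbT => v0.
  by rewrite -expR0 ler_expR mulNr oppr_le0 mulr_ge0// ltW.
- by rewrite (lt_trans _ r0)// oppr_lt0.
- rewrite (_ : exponential_prob _ _ = 1%E) ?mule1 ?opprK//.
  have : exp_dist rt (~` `]-oo, 0[%classic) = 1%E.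
    by rewrite probability_setC// [X in (_ - X)%E]exp_dist_lt0 sube0.
  by rewrite setCitvl /exp_dist /= opprK.
Qed.

Lemma exp_tilt0c m (rate c x : R) : 0 < rate -> c < rate -> 0 <= x -> is_exp m rate ->
  (\int[m]_(v in `[0%R, x]) (expR (c * v))%:E =
    (rate / (rate - c) * (1 - expR (- ((rate - c) * x))))%:E)%E.
Proof.
move=> r0 cr x0 me.
have rt : 0 < rate - c by rewrite subr_gt0.
rewrite (@exp_tilt _ rate c)//; first last.
- exists (expR (`|c| * x)) => v /=; rewrite in_itv/= => /andP[v0 vx].
  rewrite ler_expR; apply: (@le_trans _ _ (`|c| * v)).
    by rewrite ler_wpM2r// ler_norm.
  by rewrite ler_wpM2l.
- by move=> v /=; rewrite !in_itv/= andbT => /andP[].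
- by have := exp_dist_itv0c rt x0; rewrite /exp_dist/= => ->.
Qed.

End ExpLaw.

(** * Sums of exponential variables and thinning *)

Section Thinning.
Context (R : realType).
Implicit Types m e : probability R R.

Lemma exp_integral_itv m (rate : R) (f : R -> \bar R) : is_exp m rate ->
  measurable_fun setT f -> (forall x, 0 <= f x)%E ->
  (\int[m]_x f x = \int[m]_(x in `[0%R, +oo[) f x)%E.
Proof.
move=> me mf f0.
rewrite -(setUv `]-oo, 0[%classic) ge0_integral_setU//=; last 3 first.
- exact: measurableC.
- by rewrite setUv.
- by rewrite disj_set2E setICr.
rewrite null_set_integral//; last 2 first.
- exact: measurable_funTS.
- exact: is_exp_lt0 me.
by rewrite add0e setCitvl.
Qed.

Lemma exp_integral_split m (rate x : R) (f : R -> \bar R) : is_exp m rate ->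
  measurable_fun setT f -> (forall x, 0 <= f x)%E -> 0 <= x ->
  (\int[m]_x f x = \int[m]_(v in `[0%R, x]) f v + \int[m]_(v in `]x, +oo[) f v)%E.
Proof.
move=> me mf f0 x0; rewrite (exp_integral_itv me)//.
rewrite -ge0_integral_setU//=.
- congr (integral _ _ _); apply/seteqP; split => z /=; rewrite !in_itv/= !andbT.
    by move=> ->/=; have [zx|xz] := leP z x; [left|right].
  by case=> [/andP[]//|/ltW]; exact: le_trans.
- exact: measurable_funTS.
- rewrite disj_set2E; apply/eqP/seteqP; split => // z /=; rewrite !in_itv/= andbT.
  by case=> /andP[_ zx]; rewrite ltNge zx.
Qed.

Lemma measurable_exp_ray e2 (c x : R) : is_exp e2 c ->
  measurable_fun setT (fun a : R => e2 `](x - a)%R, +oo[%classic).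
Proof.
move=> h2.
rewrite (_ : (fun _ => _) = fun a : R => (if (a <= x)%R then (expR (- (c * (x - a))))%:E else 1%E)); last first.
  apply/funext => a; have [ax|xa] := leP a x.
    by rewrite h2// subr_ge0.
  by rewrite (is_exp_neg h2)// subr_lt0.
apply: measurable_fun_if => //=.
+ by apply: measurable_fun_ler.
+ apply: measurable_funTS; apply/measurable_EFinP; apply: measurableT_comp => //.
  by apply: measurableT_comp => //; apply: measurable_funM => //; exact: measurable_funB.
Qed.

(** The integral is split at [a = x]. Below [x] the second summand must exceed [x - a], which gives
    a tilted integral; above [x] it succeeds almost surely. *)
Lemma exp_sum_tail e1 e2 (lam c x : R) : 0 < lam -> 0 < c -> c < lam ->
  is_exp e1 lam -> is_exp e2 c -> 0 <= x ->
  (\int[e1]_a e2 `](x - a)%R, +oo[%classic =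
   (expR (- (c * x)) * (lam / (lam - c) * (1 - expR (- ((lam - c) * x)))) +
    expR (- (lam * x)))%:E)%E.
Proof.
move=> l0 c0 cl h1 h2 x0.
have mexp : measurable_fun setT (fun v : R => expR (c * v)).
  by apply: measurableT_comp => //; exact: measurable_funM.
have mg := measurable_exp_ray x h2.
rewrite (exp_integral_split h1 mg _ x0)//.
rewrite (eq_integral (fun v => (expR (- (c * x)))%:E * (expR (c * v))%:E)%E); last first.
  move=> v; rewrite inE/= in_itv/= => /andP[v0 vx].
  by rewrite h2 ?subr_ge0// -EFinM -expRD; congr (expR _)%:E; ring.
rewrite ge0_integralZl//; last by apply: measurable_funTS; exact/measurable_EFinP.
rewrite (exp_tilt0c l0 cl x0 h1) -EFinM.
rewrite [X in (_ + X)%E](eq_integral (cst 1%E)); last first.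
  move=> v; rewrite inE/= in_itv/= andbT => vx.
  by rewrite (is_exp_neg h2)// subr_lt0.
by rewrite integral_cst//= mul1e h1// EFinD.
Qed.

(* Exp(lam p) is a geometric(p) sum of Exp(lam) variables; this is that fact
   conditioned on the first summand. *)
Lemma exp_thinning e e' (lam p : R) (phi : R -> \bar R) : 0 < lam -> 0 < p -> p <= 1 ->
  is_exp e lam -> is_exp e' (lam * p) -> measurable_fun setT phi ->
  (forall x, 0 <= phi x)%E ->
  (\int[e']_x phi x = p%:E * \int[e]_x phi x +
    (1 - p)%:E * \int[e']_b \int[e]_a phi (b + a)%R)%E.
Proof.
move=> l0 p0 p1 he he' mphi phi0.
(* At [p = 1] the factor [lam / (lam - lam * p)] coming from [exp_sum_tail] degenerates. *)
have [p1E|pn1] := eqVneq p 1.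
  rewrite p1E subrr mul0e adde0 mul1e; apply: eq_measure_integral => A mA _.
  by apply: is_exp_unique mA; [exact: he'|rewrite p1E mulr1].
have {pn1}p1' : p < 1 by rewrite lt_neqAle pn1.
have madd : measurable_fun setT (fun z : R * R => z.1 + z.2) by exact: measurable_funD.
have q0 : 0 <= 1 - p by rewrite subr_ge0.
pose ee := (e \x e')%E.
pose conv := measure_function_pushforward__canonical__measure_function_Measure ee madd.
(* The right-hand side is integration against [m2], the mixture of [e] and of the law of the sum; it
   is enough to compare it with [e'] on rays. *)
pose m2 := [the measure _ _ of measure_add
  [the measure _ _ of mscale (NngNum (ltW p0)) e]
  [the measure _ _ of mscale (NngNum q0) conv]].
rewrite (eq_measure_integral m2); last first.
  move=> A mA _; apply: ray_unique mA.
    by rewrite [X in (X < _)%E](@probability_setT _ _ _ e') ltry.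
  move=> x; rewrite [RHS]measure_addE /=.
  rewrite /mscale/= /pushforward/= /product_measure1/=.
  rewrite (eq_integral (fun a : R => e' `](x - a)%R, +oo[%classic)); last first.
    move=> a _ /=; congr (e' _); apply/seteqP; split => b; rewrite /xsection /= in_itv/= ?inE/= ?in_itv/= !andbT; first by rewrite ltrBlDl.
    by rewrite ltrBlDl.
  have [x0|x0] := ltP x 0.
    rewrite [LHS](is_exp_neg he' x0) (is_exp_neg he x0).
    rewrite (exp_integral_itv he); last 2 first.
    - exact: measurable_exp_ray he'.
    - by [].
    rewrite (eq_integral (cst 1%E)); last first.
      move=> a; rewrite inE/= in_itv/= andbT => a0.
      by rewrite (is_exp_neg he')// subr_lt0 (lt_le_trans x0).
    rewrite integral_cst//= mul1e.
    have -> : e `[0, +oo[%classic = 1%E.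
      by rewrite -setCitvl probability_setC// (is_exp_lt0 he) sube0.
    by rewrite !mule1 -EFinD; congr EFin; ring.
  rewrite [LHS](he' _ x0) (he _ x0) (exp_sum_tail l0 _ _ he he' x0)//; last 2 first.
  - by rewrite mulr_gt0.
  - by rewrite gtr_pMr.
  rewrite -!EFinM -EFinD; congr EFin.
  have lp : lam - lam * p != 0 by rewrite subr_eq0 gt_eqF// gtr_pMr.
  have -> : expR (- (lam * x)) = expR (- (lam * p * x)) * expR (- ((lam - lam * p) * x)).
    by rewrite -expRD; congr expR; ring.
  field.
  by rewrite lp.
rewrite ge0_integral_measure_add//= !ge0_integral_mscale//; congr (_ + _ * _)%E.
rewrite (ge0_integral_pushforward madd [the measure _ _ of ee])//= preimage_setT.
rewrite fubini_tonelli2//=; last exact: (measurableT_comp mphi madd).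
by apply: eq_integral => b _; rewrite /fubini_G; apply: eq_integral => a _; rewrite addrC.
Qed.

End Thinning.

(** * Independent blocks of inputs *)

Lemma in_bigsetI (T : Type) (I : eqType) (s : seq I) (E : I -> set T) x :
  (\big[setI/setT]_(i <- s) E i) x <-> forall i, i \in s -> E i x.
Proof.
elim: s => [|j s IH]; first by rewrite big_nil.
rewrite big_cons; split.
  by move=> [Ej /IH h] i; rewrite inE => /predU1P[->//|/h].
move=> h; split; first by apply: h; rewrite inE eqxx.
by apply/IH => i si; apply: h; rewrite inE si orbT.
Qed.

Section Blocks.
Context (R : realType) (d : measure_display) (T : measurableType d).
Variables (P : probability T R) (I : eqType) (C : I -> set (set T)).
Hypotheses (CI : forall i, setI_closed (C i)) (CT : forall i, C i setT)
  (Cm : forall i, C i `<=` measurable) (indepC : mutually_independent P C).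
Implicit Types J : pred I.

(** A pi-system generating the sigma-algebra of the inputs indexed by [J]. *)
Definition cylinders J : set (set T) := [set A | exists s E,
  [/\ uniq s, (forall i, i \in s -> J i), (forall i, i \in s -> C i (E i)) &
      A = \big[setI/setT]_(i <- s) E i]].

Lemma cylindersI J : setI_closed (cylinders J).
Proof.
move=> _ _ [s [E [us sJ sE ->]]] [s' [E' [us' s'J s'E ->]]].
pose E2 i := (if i \in s then E i else setT) `&` (if i \in s' then E' i else setT).
exists (undup (s ++ s')), E2; split.
- exact: undup_uniq.
- by move=> i; rewrite mem_undup mem_cat => /orP[/sJ|/s'J].
- move=> i _; rewrite /E2; apply: CI; case: ifPn => //; [exact: sE|exact: s'E].
- apply/seteqP; split => x.
    move=> [/in_bigsetI h /in_bigsetI h']; apply/in_bigsetI => i _.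
    by split; case: ifPn => // is'; [exact: h|exact: h'].
  move=> /in_bigsetI h; split; apply/in_bigsetI => i is'.
    have /h[] : i \in undup (s ++ s') by rewrite mem_undup mem_cat is'.
    by rewrite is'.
  have /h[_] : i \in undup (s ++ s') by rewrite mem_undup mem_cat is' orbT.
  by rewrite is'.
Qed.

Lemma cylindersT J : cylinders J setT.
Proof. by exists [::], (fun=> setT); rewrite big_nil; split. Qed.

Lemma cylinders_measurable J : cylinders J `<=` measurable.
Proof.
move=> _ [s [E [_ _ sE ->]]]; rewrite big_seq; apply: bigsetI_measurable => i /sE.
exact: Cm.
Qed.

Lemma sub_cylinders J i : J i -> C i `<=` cylinders J.
Proof.
move=> Ji A CA; exists [:: i], (fun=> A); rewrite big_seq1; split => //.
- by move=> j; rewrite inE => /eqP ->.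
- by move=> j; rewrite inE => /eqP ->.
Qed.

Lemma cylinders_indep J1 J2 E F : (forall i, J1 i -> ~~ J2 i) ->
  cylinders J1 E -> cylinders J2 F -> P (E `&` F) = (P E * P F)%E.
Proof.
move=> J12 [s [E1 [us sJ sE ->]]] [s' [E2 [us' s'J s'E ->]]].
have dis i : i \in s' -> i \notin s.
  by move=> /s'J i2; apply/negP => /sJ /J12; rewrite i2.
pose E3 i := if i \in s then E1 i else E2 i.
have e1 : \big[setI/setT]_(i <- s) E1 i = \big[setI/setT]_(i <- s) E3 i.
  by apply: eq_big_seq => i is1; rewrite /E3 is1.
have e2 : \big[setI/setT]_(i <- s') E2 i = \big[setI/setT]_(i <- s') E3 i.
  by apply: eq_big_seq => i /dis is1; rewrite /E3 (negbTE is1).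
have E3C i : i \in s ++ s' -> C i (E3 i).
  rewrite mem_cat /E3; case: ifPn => [/sE//|_/=]; exact: s'E.
have us2 : uniq (s ++ s').
  by rewrite cat_uniq us us' andbT/=; apply/hasPn => i /= /dis.
rewrite e1 e2 -big_cat (indepC us2 E3C) big_cat/=; congr (_ * _)%E.
  by rewrite indepC// => i is'; apply: E3C; rewrite mem_cat is'.
by rewrite indepC// => i is'; apply: E3C; rewrite mem_cat is' orbT.
Qed.

Lemma sigma_cylinders_measurable J : <<s cylinders J >> `<=` measurable.
Proof.
by apply: smallest_sub; [exact: sigma_algebra_measurable|exact: cylinders_measurable].
Qed.

(** Cylinders over disjoint index sets are independent because their concatenated index lists are
    still duplicate-free. Independence then passes to the generated sigma-algebras, one side at a
    time. *)
Lemma block_indep J1 J2 E F : (forall i, J1 i -> ~~ J2 i) ->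
  <<s cylinders J1 >> E -> <<s cylinders J2 >> F ->
  P (E `&` F) = (P E * P F)%E.
Proof.
move=> J12 sE sF.
(* For fixed [A], both sides are finite measures in [B] that agree on the cylinders. *)
have ext J (A : set T) : measurable A ->
    (forall B, cylinders J B -> P (B `&` A) = (P B * P A)%E) ->
    forall B, <<s cylinders J >> B -> P (B `&` A) = (P B * P A)%E.
  move=> mA PA B sB.
  pose m1 := [the measure _ _ of mrestr P mA].
  have PA0 : 0 <= fine (P A) by rewrite fine_ge0.
  pose m2 := [the measure _ _ of mscale (NngNum PA0) P].
  have : m1 B = m2 B.
    apply: (g_sigma_algebra_measure_unique (cylinders J) _ (fun=> setT)) => //.
    - exact: cylinders_measurable.
    - by move=> _; exact: cylindersT.
    - by rewrite bigcup_const.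
    - exact: cylindersI.
    - move=> D JD; rewrite /m1 /m2 /= /mrestr /mscale /= PA//.
      by rewrite fineK ?fin_num_measure// muleC.
    - by move=> _; rewrite /m1 /= /mrestr setTI -ge0_fin_numE// fin_num_measure.
  rewrite /m1 /m2 /= /mrestr /mscale /= => ->.
  by rewrite fineK ?fin_num_measure// muleC.
apply: (ext J1) => //; first exact: sigma_cylinders_measurable sF.
move=> B JB; rewrite setIC muleC; apply: (ext J2) => //.
  exact: cylinders_measurable JB.
by move=> D JD; rewrite setIC muleC; exact: cylinders_indep JB JD.
Qed.

End Blocks.

(** * Sub-sigma-algebras generated by blocks of inputs *)

Section Model.
Variables (R : realType) (k n : nat) (M : fj_input R k n) (lam mu : R).
Hypothesis HM : fj_base M lam mu.
Local Notation P := (fji_P M).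
Implicit Types J : pred (fj_index n).

Lemma fj_eventsI x : setI_closed (@fj_events R k n M x).
Proof.
case: x => [[m|m]|[m s]] _ _ [A mA <-] [B mB <-]; exists (A `&` B) => //.
- exact: (@measurableI _ R).
- exact: (@measurableI _ R).
Qed.

Lemma fj_eventsT x : @fj_events R k n M x setT.
Proof. by case: x => [[m|m]|[m s]]; exists setT => //; exact: (@measurableT _ R). Qed.

Lemma fj_events_measurable x : @fj_events R k n M x `<=` measurable.
Proof.
have [mA [mO mS _ _ _]] := HM.
case: x => [[m|m]|[m s]] _ [B mB <-].
- by rewrite -[X in measurable X]setTI; exact: mA.
- exact: mO.
- by rewrite -[X in measurable X]setTI; exact: mS.
Qed.

(** The sample space with a smaller sigma-algebra: measurability from [block M J] expresses
    dependence on the inputs of [J] alone. *)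
Definition block J := g_sigma_algebraType (cylinders (@fj_events R k n M) J).

HB.instance Definition _ J := Measurable.on (block J).

Lemma block_measurable J d' (V : measurableType d') (f : fji_T M -> V) :
  measurable_fun setT (f : block J -> V) -> measurable_fun setT f.
Proof.
move=> mf _ B mB; have /(_ measurableT B mB) := mf.
by apply: sigma_cylinders_measurable; exact: fj_events_measurable.
Qed.

Lemma block_A J m : J (inl (inl m)) ->
  measurable_fun setT (fji_A M m : block J -> R).
Proof.
move=> Jm _ B mB; apply: sub_sigma_algebra; apply: (sub_cylinders Jm).
by exists B => //; rewrite setTI.
Qed.

Lemma block_O J m (B : set 'I_k) : J (inl (inr m)) ->
  measurable (fji_O M m @^-1` B : set (block J)).
Proof.
by move=> Jm; apply: sub_sigma_algebra; apply: (sub_cylinders Jm); exists B.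
Qed.

Lemma block_S J m s : J (inr (m, s)) ->
  measurable_fun setT (fji_S M m s : block J -> R).
Proof.
move=> Jm _ B mB; apply: sub_sigma_algebra; apply: (sub_cylinders Jm).
by exists B => //; rewrite setTI.
Qed.

Lemma blocks_indep J1 J2 (E : set (block J1)) (F : set (block J2)) :
  (forall i, J1 i -> ~~ J2 i) -> measurable E -> measurable F ->
  P (E `&` F) = (P E * P F)%E.
Proof.
have [_ [_ _ ind _ _]] := HM.
move=> J12 mE mF; apply: (block_indep _ _ _ ind J12) => //.
- exact: fj_eventsI.
- exact: fj_eventsT.
- exact: fj_events_measurable.
Qed.

End Model.

(** * Sample-path inequalities *)

Lemma tnth_mktupleE (X : Type) (n : nat) (f : 'I_n -> X) : tnth [tuple f i | i < n] = f.
Proof. by apply/funext => i; rewrite tnth_mktuple. Qed.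

(** Sojourn times in an initially empty FCFS single-server queue with interarrival times [A] and
    service times [V]. *)
Fixpoint lindley (R : realType) (A V : nat -> R) (m : nat) : R :=
  if m is m'.+1 then Num.max 0 (lindley A V m' - A m'.+1) + V m'.+1 else V 0.

(** A negative value stays negative after subtracting [a >= 0]; hence workloads may be truncated at
    every arrival without changing later ones. *)
Lemma max0_sub (R : realType) (y a : R) : 0 <= a ->
  Num.max 0 (y - a) = Num.max 0 (Num.max 0 y - a).
Proof.
move=> a0; have [y0|y0] := leP 0 y; first by [].
by rewrite sub0r !max_l// ?oppr_le0// subr_le0 (le_trans (ltW y0)).
Qed.

Section Paths.
Variables (R : realType) (k n t : nat).
Variables (sys : 'I_k -> 'I_n) (rec : 'I_k -> 'I_t -> {set 'I_n}).
Implicit Types (F S : 'I_n -> R) (a : R) (i : 'I_k).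

Notation depart := (@fj_depart R k n t sys rec).
Notation fstep := (@fj_free_step R k n t sys rec).

Definition duration i S : R := depart (fun=> 0) 0 i S.

(** Between arrivals every residual workload decreases at unit rate down to 0. *)
Definition drift a (y : n.-tuple R) : n.-tuple R :=
  [tuple Num.max 0 (tnth y s - a) | s < n].

(** The arrival is placed at time 0, so free times and residual workloads coincide. *)
Definition serve i (y s : n.-tuple R) : n.-tuple R :=
  [tuple fstep (tnth y) 0 i (tnth s) j | j < n].

(* Workload of the servers seen by request m when only the requests for f_i
   are kept. *)
Fixpoint thinned i (A : nat -> R) (O : nat -> 'I_k) (S : nat -> 'I_n -> R) m : n.-tuple R :=
  if m is m'.+1 then
    drift (A m'.+1) (if O m' == i then serve i (thinned i A O S m') [tuple S m' s | s < n]
                     else thinned i A O S m')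
  else [tuple 0 | _ < n].

(** Time is measured from the arrival: subtracting [a] commutes with minima and maxima and turns the
    default [a] of the inner maxima into 0. *)
Lemma depart_shift F a i S :
  depart F a i S - a = depart (fun s => Num.max 0 (F s - a)) 0 i S.
Proof.
have e s : Num.max a (F s) + S s - a = Num.max 0 (Num.max 0 (F s - a)) + S s.
  by rewrite maxA maxxx addrAC addr_maxl subrr.
rewrite /fj_depart (big_morph (fun x => x - a) (fun x y => addr_minl x y (- a)) (erefl _)) e.
apply: eq_bigr => g _.
rewrite (big_morph (fun x => x - a) (fun x y => addr_maxl x y (- a)) (subrr a)).
by apply: eq_bigr => s _; exact: e.
Qed.

Lemma depart_le F F' a a' i S : (forall s, F s <= F' s) -> a <= a' ->
  depart F a i S <= depart F' a' i S.
Proof.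
move=> FF aa; rewrite /fj_depart.
have fin s : Num.max a (F s) + S s <= Num.max a' (F' s) + S s.
  by rewrite lerD2r ge_max !le_max aa FF orbT.
elim/big_ind2 : _ => // [x1 x2 y1 y2 h1 h2|g _].
  by rewrite le_min !ge_min h1 h2 orbT.
elim/big_ind2 : _ => // x1 x2 y1 y2 h1 h2.
by rewrite ge_max !le_max h1 h2 orbT.
Qed.

Lemma fstep_le F F' a i S : (forall s, F s <= F' s) -> forall s,
  fstep F a i S s <= fstep F' a i S s.
Proof.
move=> FF s; rewrite /fj_free_step; case: ifPn => // _.
rewrite ge_max !le_max FF/=; apply/orP; right.
rewrite le_min !ge_min (@depart_le F F' a a)// orbT andbT.
by rewrite lerD2r ge_max !le_max lexx FF orbT.
Qed.

Lemma fstep_ge F a i S s : F s <= fstep F a i S s.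
Proof. by rewrite /fj_free_step; case: ifPn => // _; rewrite le_max lexx. Qed.

Lemma fstep_shift F a i S s : Num.max 0 (fstep F a i S s - a) =
  fstep (fun s => Num.max 0 (F s - a)) 0 i S s.
Proof.
rewrite /fj_free_step; case: ifPn => // _.
rewrite -depart_shift maxA maxxx.
rewrite addr_maxl addr_minl addrAC addr_maxl subrr maxA//.
Qed.

Lemma depart_idle b i S : depart (fun=> b) b i S = duration i S + b.
Proof.
apply/eqP; rewrite -subr_eq depart_shift; apply/eqP.
by rewrite /duration; congr (depart _ _ _ _); apply/funext => _; rewrite subrr maxxx.
Qed.

Section Sequence.
Variables (A : nat -> R) (O : nat -> 'I_k) (S : nat -> 'I_n -> R).
Hypothesis A0 : forall m, 0 <= A m.
Notation free := (fj_free sys rec A O S).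
Notation workload m := (fun s => Num.max 0 (free m s - arrival A m)).

Lemma arrivalS m : arrival A m.+1 = arrival A m + A m.+1.
Proof. by rewrite /arrival big_ord_recr. Qed.

Lemma workload0 s : Num.max 0 (free 0 s - arrival A 0) = 0.
Proof. by rewrite /= /arrival big_ord1 sub0r max_l// oppr_le0. Qed.

Lemma workloadS m s : Num.max 0 (free m.+1 s - arrival A m.+1) =
  Num.max 0 (fstep (workload m) 0 (O m) (S m) s - A m.+1).
Proof. by rewrite -fstep_shift -max0_sub// arrivalS opprD addrA. Qed.

Lemma downloadE m :
  fj_download sys rec A O S m = depart (workload m) 0 (O m) (S m).
Proof. by rewrite /fj_download depart_shift. Qed.

(** By induction: a kept request acts monotonically on the workloads ([fstep_le]), and a dropped one
    could only have increased them ([fstep_ge]). *)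
Lemma thinned_le i m s : tnth (thinned i A O S m) s <= Num.max 0 (free m s - arrival A m).
Proof.
elim: m s => [|m IH] s; first by rewrite workload0 tnth_mktuple.
rewrite workloadS [thinned _ _ _ _ _]/= tnth_mktuple.
rewrite ge_max !le_max lexx/= orbC lerD2r.
case: eqP => [->|_]; last by rewrite (le_trans (IH s))// fstep_ge.
by rewrite tnth_mktuple tnth_mktupleE fstep_le.
Qed.

Lemma download_ge_thinned m :
  depart (tnth (thinned (O m) A O S m)) 0 (O m) (S m) <= fj_download sys rec A O S m.
Proof. by rewrite downloadE; apply: depart_le => // s; exact: thinned_le. Qed.

Lemma download_thinned i m : (forall j, O j = i) ->
  fj_download sys rec A O S m = depart (tnth (thinned i A O S m)) 0 i (S m).
Proof.
move=> Oi; rewrite downloadE Oi; congr (depart _ _ _ _); apply/funext => s.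
elim: m s => [|m IH] s; first by rewrite workload0 tnth_mktuple.
rewrite workloadS [thinned _ _ _ _ _]/= tnth_mktuple Oi eqxx tnth_mktuple tnth_mktupleE.
by congr (Num.max 0 (fstep _ _ _ _ _ - _)); apply/funext => j; exact: IH.
Qed.

Lemma sm_downloadE m :
  sm_download sys rec A O S m = lindley A (fun j => duration (O j) (S j)) m.
Proof.
rewrite /sm_download.
elim: m => [|m IH].
  by rewrite /= depart_idle /arrival big_ord1 max_l// addrK.
rewrite [lindley _ _ _]/= -IH; rewrite (_ : sm_depart _ _ _ _ _ m.+1 = depart (fun=> Num.max (arrival A m.+1)
  (sm_depart sys rec A O S m)) (Num.max (arrival A m.+1)
  (sm_depart sys rec A O S m)) (O m.+1) (S m.+1))// depart_idle -addrA addrC; congr (_ + _).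
by rewrite addr_maxl subrr arrivalS opprD addrA.
Qed.

Hypothesis S0 : forall m s, 0 <= S m s.

Lemma duration_ge0 i S' : (forall s, 0 <= S' s) -> 0 <= duration i S'.
Proof.
move=> h; rewrite /duration /fj_depart.
elim/big_ind : _ => [|x y x0 y0|g _].
- by rewrite maxxx add0r.
- by rewrite le_min x0.
- elim/big_ind : _ => // [x y x0 y0|s _]; first by rewrite le_max x0.
  by rewrite maxxx add0r.
Qed.

(** Here [z] is the waiting time in split-merge. The invariant [wz] keeps every fork-join workload
    below it: no server is held past the departure, which by [dep] comes no later than in
    split-merge. *)
Lemma download_le_sm m :
  fj_download sys rec A O S m <= sm_download sys rec A O S m.
Proof.
rewrite sm_downloadE; set V := fun j => _.
pose z m := if m is m'.+1 then Num.max 0 (lindley A V m' - A m'.+1) else 0.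
have zL j : lindley A V j = z j + V j by case: j => [|j] //=; rewrite add0r.
have z0 j : 0 <= z j by case: j => [|j] //=; rewrite le_max lexx.
have dep j : (forall s, Num.max 0 (free j s - arrival A j) <= z j) ->
    depart (workload j) 0 (O j) (S j) <= lindley A V j.
  move=> h; apply: (@le_trans _ _ (depart (fun=> z j) (z j) (O j) (S j))).
    exact: depart_le.
  by rewrite depart_idle zL addrC.
have wz j s : Num.max 0 (free j s - arrival A j) <= z j.
  elim: j s => [|j IH] s; first by rewrite workload0.
  rewrite workloadS /= ge_max !le_max lexx/= lerD2r; apply/orP; right.
  have zj : z j <= lindley A V j by rewrite zL lerDl duration_ge0.
  rewrite /fj_free_step; case: ifPn => _; last exact: le_trans (IH s) zj.
  by rewrite ge_max (le_trans (IH s) zj)/= ge_min dep// orbT.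
by rewrite downloadE; exact: dep.
Qed.

End Sequence.

(** With [c g] a representative of group [g], this is the shortest of [t + 1] service times; a group
    never finishes before its representative. *)
Definition fastest i (c : 'I_t -> 'I_n) S : R :=
  \big[Num.min/S (sys i)]_(g < t) S (c g).

(** The invariant is that the systematic server and all representatives carry at least the waiting
    time [z] of the single-server queue. Each is then busy until its own finish or the departure,
    and neither comes before [z + V]. *)
Lemma lindley_le_thinned i (c : 'I_t -> 'I_n) A O (S : nat -> 'I_n -> R) m :
  (forall g, c g \in rec i g) -> (forall j, O j = i) ->
  lindley A (fun j => fastest i c (S j)) m <=
  depart (tnth (thinned i A O S m)) 0 i (S m).
Proof.
move=> cr Oi; set V := fun j => _.
pose z m := if m is m'.+1 then Num.max 0 (lindley A V m' - A m'.+1) else 0.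
have zL j : lindley A V j = z j + V j by case: j => [|j] //=; rewrite add0r.
pose C s := s = sys i \/ exists g, s = c g.
have VS j s : C s -> V j <= S j s.
  rewrite /V /fastest => -[->|[g ->]].
    exact: bigmin_le_id.
  by apply: bigmin_le_cond.
have dep j : (forall s, C s -> z j <= tnth (thinned i A O S j) s) ->
    lindley A V j <= depart (tnth (thinned i A O S j)) 0 i (S j).
  move=> h; rewrite /fj_depart zL.
  have fin s : C s -> z j + V j <= Num.max 0 (tnth (thinned i A O S j) s) + S j s.
    by move=> Cs; rewrite lerD ?VS// le_max h ?orbT.
  elim/big_ind : _ => [|x y x0 y0|g _].
  - by apply: fin; left.
  - by rewrite le_min x0.
  - apply: (le_trans (fin (c g) _)); first by right; exists g.
    by apply: le_bigmax_cond.
apply: (dep m); elim: m => [|m IH] s Cs; first by rewrite tnth_mktuple.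
rewrite [thinned _ _ _ _ _]/= tnth_mktuple Oi eqxx tnth_mktuple tnth_mktupleE /=.
rewrite ge_max !le_max lexx/= lerD2r; apply/orP; right.
have sF : s \in fj_servers sys rec i.
  rewrite /fj_servers in_setU1; case: Cs => [->|[g ->]]; first by rewrite eqxx.
  by apply/orP; right; apply/bigcupP; exists g.
rewrite /fj_free_step sF le_max; apply/orP; right.
rewrite le_min dep// andbT zL lerD ?VS// le_max IH// orbT//.
Qed.

End Paths.

(** * Laws of the inputs *)

Section MeasurableDynamics.
Context (R : realType) (d : measure_display) (T : measurableType d) (k n t : nat).
Variables (sys : 'I_k -> 'I_n) (rec : 'I_k -> 'I_t -> {set 'I_n}).

Lemma measurable_bigmin (I : Type) (s : seq I) (Q : pred I) (f : I -> T -> R) (g : T -> R) :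
  measurable_fun setT g -> (forall i, measurable_fun setT (f i)) ->
  measurable_fun setT (fun w => \big[Num.min/g w]_(i <- s | Q i) f i w).
Proof.
move=> mg mf; elim: s => [|i s IH]; first by under eq_fun do rewrite big_nil.
under eq_fun do rewrite big_cons; case: (Q i) => //.
exact: measurable_minr.
Qed.

Lemma measurable_bigmax (I : Type) (s : seq I) (Q : pred I) (f : I -> T -> R) (g : T -> R) :
  measurable_fun setT g -> (forall i, measurable_fun setT (f i)) ->
  measurable_fun setT (fun w => \big[Num.max/g w]_(i <- s | Q i) f i w).
Proof.
move=> mg mf; elim: s => [|i s IH]; first by under eq_fun do rewrite big_nil.
under eq_fun do rewrite big_cons; case: (Q i) => //.
exact: measurable_maxr.
Qed.

Lemma measurable_depart (F S : T -> 'I_n -> R) (a : T -> R) i :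
  (forall s, measurable_fun setT (F ^~ s)) -> measurable_fun setT a ->
  (forall s, measurable_fun setT (S ^~ s)) ->
  measurable_fun setT (fun w => fj_depart sys rec (F w) (a w) i (S w)).
Proof.
move=> mF ma mS; rewrite /fj_depart.
have fin s : measurable_fun setT (fun w => Num.max (a w) (F w s) + S w s).
  by apply: measurable_funD => //; exact: measurable_maxr.
by apply: measurable_bigmin => // g; exact: measurable_bigmax.
Qed.

Lemma measurable_free_step (F S : T -> 'I_n -> R) (a : T -> R) i s :
  (forall s, measurable_fun setT (F ^~ s)) -> measurable_fun setT a ->
  (forall s, measurable_fun setT (S ^~ s)) ->
  measurable_fun setT (fun w => fj_free_step sys rec (F w) (a w) i (S w) s).
Proof.
move=> mF ma mS.
rewrite /fj_free_step; case: (s \in fj_servers sys rec i) => //.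
apply: measurable_maxr; first exact: mF.
apply: measurable_minr; last exact: measurable_depart.
by apply: measurable_funD => //; exact: measurable_maxr.
Qed.

Lemma measurable_serve i (Y S : T -> n.-tuple R) :
  measurable_fun setT Y -> measurable_fun setT S ->
  measurable_fun setT (fun w => serve sys rec i (Y w) (S w)).
Proof.
move=> /measurable_fun_tnthP mY /measurable_fun_tnthP mS.
apply/measurable_fun_tnthP => s.
rewrite [X in measurable_fun _ X](_ : _ = fun w => fj_free_step sys rec (tnth (Y w)) 0 i (tnth (S w)) s); last first.
  by apply/funext => w /=; rewrite tnth_mktuple.
exact: measurable_free_step.
Qed.

Lemma measurable_drift (A : T -> R) (Y : T -> n.-tuple R) :
  measurable_fun setT A -> measurable_fun setT Y ->
  measurable_fun setT (fun w => drift (A w) (Y w)).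
Proof.
move=> mA /measurable_fun_tnthP mY; apply/measurable_fun_tnthP => s.
rewrite [X in measurable_fun _ X](_ : _ = fun w => Num.max 0 (tnth (Y w) s - A w)); last first.
  by apply/funext => w /=; rewrite tnth_mktuple.
by apply: measurable_maxr => //; apply: measurable_funB => //; exact: mY.
Qed.

Lemma measurable_mktuple (N : nat) (f : 'I_N -> T -> R) :
  (forall l, measurable_fun setT (f l)) ->
  measurable_fun setT (fun w => [tuple f l w | l < N]).
Proof.
move=> mf; apply/measurable_fun_tnthP => l.
rewrite [X in measurable_fun _ X](_ : _ = f l); first exact: mf.
by apply/funext => w /=; rewrite tnth_mktuple.
Qed.

(** The preimage splits over the finitely many values of [o]. *)
Lemma measurable_case (d' : measure_display) (V : measurableType d') (o : T -> 'I_k)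
    (f : 'I_k -> T -> V) :
  (forall B : set 'I_k, measurable (o @^-1` B)) -> (forall i, measurable_fun setT (f i)) ->
  measurable_fun setT (fun w => f (o w) w).
Proof.
move=> mo mf _ B mB; rewrite setTI.
rewrite (_ : _ @^-1` _ = \big[setU/set0]_(i < k) (o @^-1` [set i] `&` f i @^-1` B)).
  apply: bigsetU_measurable => i _; apply: measurableI; first exact: mo.
  by rewrite -[X in measurable X]setTI; exact: mf.
apply/seteqP; split => w /=.
  by move=> Bw; rewrite -bigcup_seq; exists (o w); rewrite /= ?mem_index_enum.
by rewrite -bigcup_seq => -[i _ /= [<-]].
Qed.

End MeasurableDynamics.

Section TupleLaw.
Context (R : realType) (N : nat).
Implicit Types al be : probability (N.-tuple R) R.

Definition box (B : 'I_N -> set R) : set (N.-tuple R) :=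
  [set y | forall l, B l (tnth y l)].

Lemma box_measurable B : (forall l, measurable (B l)) -> measurable (box B).
Proof.
move=> mB; rewrite (_ : box B = \big[setI/setT]_(l < N) (fun y => tnth y l) @^-1` B l).
  apply: bigsetI_measurable => l _; rewrite -[X in measurable X]setTI.
  exact: measurable_tnth.
apply/seteqP; split => y.
  by move=> By; apply/in_bigsetI => l _; exact: By.
by move=> /in_bigsetI By l; apply: By; exact: mem_index_enum.
Qed.

(** Boxes form a pi-system; they generate because a constraint on one coordinate is a box with
    [setT] elsewhere. *)
Lemma tuple_law_unique al be :
  (forall B, (forall l, measurable (B l)) -> al (box B) = be (box B)) ->
  forall E, measurable E -> al E = be E.
Proof.
move=> ab E mE.
pose G : set (set (N.-tuple R)) := [set D | exists2 B, (forall l, measurable (B l)) & D = box B].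
refine (@measure_unique _ R _ G (fun=> setT) _ _ _ _ al be _ _ E mE).
- apply/seteqP; split.
    apply: smallest_sub; first exact: smallest_sigma_algebra.
    move=> D; rewrite -bigcup_seq => -[l _ /= [B mB <-]].
    apply: sub_sigma_algebra; exists (fun j => if j == l then B else setT).
      by move=> j; case: ifP.
    rewrite setTI; apply/seteqP; split => y /=.
      by move=> By j; case: eqP => [->|].
    by move=> /(_ l); rewrite eqxx.
  apply: smallest_sub; first exact: sigma_algebra_measurable.
  by move=> _ [B mB ->]; exact: box_measurable.
- move=> _ _ [B mB ->] [B' mB' ->]; exists (fun l => B l `&` B' l).
    by move=> l; exact: measurableI.
  apply/seteqP; split => y /=; first by move=> [h h'] l; split.
  by move=> h; split=> l; have [] := h l.
- move=> _; exists (fun=> setT) => //.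
  by apply/seteqP; split.
- by rewrite bigcup_const.
- by move=> _ [B mB ->]; exact: ab.
- by move=> _; rewrite [X in (X < _)%E](@probability_setT _ _ _ al) ltry.
Qed.

End TupleLaw.

(** * Joint law of the service times of a request *)

Section ModelLaws.
Context (R : realType) (k n : nat) (M : fj_input R k n) (lam mu : R).
Hypothesis HM : fj_base M lam mu.
Local Notation P := (fji_P M).

Lemma measurable_A m : measurable_fun setT (fji_A M m).
Proof. by have [] := HM. Qed.

Lemma measurable_S m s : measurable_fun setT (fji_S M m s).
Proof. by have [_ []] := HM. Qed.

Lemma exp_law rate (X : fji_T M -> R) (mX : measurable_fun setT X) :
  exp_tail rate X -> is_exp (law P mX) rate.
Proof.
move=> h x x0; rewrite lawE -(h x x0).
by have -> : X @^-1` `]x, +oo[%classic = [set w | x < X w]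
  by apply/seteqP; split => w /=; rewrite in_itv/= andbT.
Qed.

Lemma A_law m : is_exp (law P (measurable_A m)) lam.
Proof. by apply: exp_law; have [_ [_ _ _ h _]] := HM. Qed.

Lemma S_law m s : is_exp (law P (measurable_S m s)) mu.
Proof. by apply: exp_law; have [_ [_ _ _ _ h]] := HM. Qed.

Lemma A_ge0 m : P [set w | ~ (0 <= fji_A M m w)] = 0%E.
Proof.
have := is_exp_lt0 (A_law m); rewrite lawE => <-.
suff -> : [set w | ~ 0 <= fji_A M m w] = fji_A M m @^-1` `]-oo, 0[%classic by [].
by apply/seteqP; split => w /=; rewrite in_itv/= ltNge => /negP.
Qed.

Lemma S_ge0 m s : P [set w | ~ (0 <= fji_S M m s w)] = 0%E.
Proof.
have := is_exp_lt0 (S_law m s); rewrite lawE => <-.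
suff -> : [set w | ~ 0 <= fji_S M m s w] = fji_S M m s @^-1` `]-oo, 0[%classic by [].
by apply/seteqP; split => w /=; rewrite in_itv/= ltNge => /negP.
Qed.

Definition services (N : nat) (f : 'I_N -> 'I_n) m w : N.-tuple R :=
  [tuple fji_S M m (f l) w | l < N].

Lemma measurable_services N (f : 'I_N -> 'I_n) m : measurable_fun setT (services f m).
Proof. by apply: measurable_mktuple => l; exact: measurable_S. Qed.

Lemma services_box (hmu : 0 < mu) N (f : 'I_N -> 'I_n) m (B : 'I_N -> set R) :
  injective f -> (forall l, measurable (B l)) ->
  P (services f m @^-1` box B) = (\big[*%E/1%E]_(l < N) exp_dist hmu (B l))%E.
Proof.
move=> finj mB; have [_ [_ _ ind _ _]] := HM.
(* The box is indexed by positions [l], independence by inputs. [E] moves the constraint of [l] to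
   the input [(m, f l)]; injectivity of [f] makes the position found by [pick] the right one. *)
pose E (x : fj_index n) : set (fji_T M) := if x is inr (_, s) then
  (if [pick l | f l == s] is Some l then fji_S M m s @^-1` B l else setT) else setT.
pose g l : fj_index n := inr (m, f l).
have Ef l : E (g l) = fji_S M m (f l) @^-1` B l.
  by rewrite /E /g; case: pickP => [j /eqP/finj ->//|/(_ l)]; rewrite eqxx.
have ginj : injective g by move=> a b [] /finj.
have := ind [seq g l | l <- index_enum 'I_N] E _ _.
rewrite !big_map (_ : \big[setI/setT]_(l <- _) _ = services f m @^-1` box B); last first.
  apply/seteqP; split => w /=.
    move=> /in_bigsetI h l; rewrite tnth_mktuple.
    suff : E (g l) w by rewrite Ef.
    exact: h (mem_index_enum l).
  move=> h; apply/in_bigsetI => l _; suff : E (g l) w by [].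
  by rewrite Ef; have := h l; rewrite tnth_mktuple.
move=> -> //.
- apply: eq_bigr => l _; rewrite Ef.
  rewrite -(lawE P (measurable_S m (f l))).
  by apply: is_exp_unique (S_law _ _) (exp_dist_ray _) _ _.
- by rewrite map_inj_uniq// index_enum_uniq.
- move=> _ /mapP[l _ ->]; rewrite Ef /=.
  by exists (B l).
Qed.

End ModelLaws.
Arguments services {R k n} M {N} f m w.

(** Both laws give a box the same product of exponential probabilities, whatever the model, the
    request and the distinct servers observed. *)
Lemma services_law (R : realType) (k n : nat) (M M' : fj_input R k n) (lam lam' mu : R)
    (HM : fj_base M lam mu) (HM' : fj_base M' lam' mu) (hmu : 0 < mu)
    N (f f' : 'I_N -> 'I_n) m m' E : injective f -> injective f' -> measurable E ->
  fji_P M (services M f m @^-1` E) = fji_P M' (services M' f' m' @^-1` E).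
Proof.
move=> fi fi' mE.
have h B : (forall l, measurable (B l)) ->
    law (fji_P M) (measurable_services HM f m) (box B) =
    law (fji_P M') (measurable_services HM' f' m') (box B).
  move=> mB; rewrite (lawE (fji_P M)) (services_box HM hmu m fi mB).
  by rewrite (lawE (fji_P M')) (services_box HM' hmu m' fi' mB).
have := tuple_law_unique h mE.
by rewrite (lawE (fji_P M)) (lawE (fji_P M')).
Qed.

(** * Integrating out inputs independent of the past *)

Section BlockIntegral.
Context (R : realType) (k n : nat) (M : fj_input R k n) (lam mu : R).
Hypothesis HM : fj_base M lam mu.
Local Notation P := (fji_P M).
Local Notation T := (fji_T M).
Context (d1 d2 : measure_display) (U : measurableType d1) (V : measurableType d2).
Variables (J1 J2 : pred (fj_index n)).
Hypothesis J12 : forall x, J1 x -> ~~ J2 x.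

Lemma block_integral_on (X : T -> U) (Y : T -> V) (H : set T) (be : probability V R)
    (c : R) (f : U * V -> \bar R) :
  measurable_fun setT (X : block M J1 -> U) -> measurable_fun setT (Y : block M J2 -> V) ->
  measurable (H : set (block M J2)) -> 0 <= c ->
  (forall F, measurable F -> P (H `&` Y @^-1` F) = (c%:E * be F)%E) ->
  measurable_fun setT f -> (forall z, 0 <= f z)%E ->
  (\int[P]_(w in H) f (X w, Y w) = c%:E * \int[P]_w \int[be]_y f (X w, y))%E.
Proof.
move=> bX bY bH c0 YF mf f0.
have mX := block_measurable HM bX; have mY := block_measurable HM bY.
have mH : measurable H.
  by apply: sigma_cylinders_measurable bH; exact: fj_events_measurable HM.
rewrite (@indep_integral_on _ _ _ _ _ _ _ P X Y H mX mY mH (law P mX) be (NngNum c0))//=.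
  rewrite (@ge0_integral_law _ _ _ _ _ P X mX)//.
  - exact: measurable_fun_fubini_tonelli_F.
  - by move=> x; apply: integral_ge0 => y _; exact: f0.
move=> E F mE mF; rewrite setICA (blocks_indep HM J12).
- by rewrite YF// muleCA.
- by have /(_ measurableT E mE) := bX; rewrite setTI.
- apply: measurableI => //.
  by have /(_ measurableT F mF) := bY; rewrite setTI.
Qed.

Lemma block_integral (X : T -> U) (Y : T -> V) (be : probability V R) (f : U * V -> \bar R) :
  measurable_fun setT (X : block M J1 -> U) -> measurable_fun setT (Y : block M J2 -> V) ->
  (forall F, measurable F -> P (Y @^-1` F) = be F) ->
  measurable_fun setT f -> (forall z, 0 <= f z)%E ->
  (\int[P]_w f (X w, Y w) = \int[P]_w \int[be]_y f (X w, y))%E.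
Proof.
move=> bX bY YF mf f0.
rewrite (@block_integral_on X Y setT be 1)// ?mul1e//.
by move=> F mF; rewrite setTI mul1e YF.
Qed.

End BlockIntegral.

(** * Requests for one object *)

Section Operators.
Context (R : realType) (k n t : nat).
Variables (sys : 'I_k -> 'I_n) (rec : 'I_k -> 'I_t -> {set 'I_n}) (i : 'I_k).
Implicit Types (phi : n.-tuple R -> \bar R) (y z : n.-tuple R).
Implicit Types (e : probability R R) (sg : probability (n.-tuple R) R).

(** The class on which workloads are compared: it contains the download tails and is preserved by
    [drift_op] and [serve_op]. *)
Definition test_fun phi := [/\ measurable_fun setT phi, (forall y, 0 <= phi y <= 1)%E &
  forall y y', (forall s, tnth y s <= tnth y' s) -> (phi y <= phi y')%E].

Definition drift_op e phi z := (\int[e]_a phi (drift a z))%E.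
Definition serve_op sg phi y := (\int[sg]_s phi (serve sys rec i y s))%E.

Lemma serve_opE sg phi y : serve_op sg phi y = (\int[sg]_s phi (serve sys rec i y s))%E.
Proof. by []. Qed.

Lemma test_fun_ge0 phi y : test_fun phi -> (0 <= phi y)%E.
Proof. by move=> [_ /(_ y)/andP[]]. Qed.

Lemma integral_le1 (d : measure_display) (V : measurableType d) (m : probability V R)
    (f : V -> \bar R) : measurable_fun setT f -> (forall v, 0 <= f v <= 1)%E ->
  (\int[m]_v f v <= 1)%E.
Proof.
move=> mf f01; apply: (@le_trans _ _ (\int[m]_v cst 1 v)%E).
  by apply: ge0_le_integral => // v _; have /andP[] := f01 v.
by rewrite integral_cst// mul1e probability_le1.
Qed.

Lemma measurable_drift_fun phi : measurable_fun setT phi ->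
  measurable_fun setT (fun za : n.-tuple R * R => phi (drift za.2 za.1)).
Proof. by move=> mphi; apply: (measurableT_comp mphi); exact: measurable_drift. Qed.

Lemma measurable_serve_fun phi : measurable_fun setT phi ->
  measurable_fun setT (fun ys : n.-tuple R * n.-tuple R => phi (serve sys rec i ys.1 ys.2)).
Proof. by move=> mphi; apply: (measurableT_comp mphi); exact: measurable_serve. Qed.

Lemma measurable_drift1 phi z : measurable_fun setT phi ->
  measurable_fun setT (fun a : R => phi (drift a z)).
Proof. by move=> mphi; apply: (measurableT_comp mphi); exact: measurable_drift. Qed.

Lemma measurable_serve1 phi y : measurable_fun setT phi ->
  measurable_fun setT (fun s : n.-tuple R => phi (serve sys rec i y s)).
Proof. by move=> mphi; apply: (measurableT_comp mphi); exact: measurable_serve. Qed.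

Lemma test_drift_op e phi : test_fun phi -> test_fun (drift_op e phi).
Proof.
move=> tphi; have [mphi phi01 phile] := tphi; split.
- have := @measurable_fun_fubini_tonelli_F _ _ _ _ R e _ (measurable_drift_fun mphi).
  by apply=> z; exact: test_fun_ge0.
- move=> z; rewrite integral_ge0/=; last by move=> a _; exact: test_fun_ge0.
  by apply: integral_le1 => //; exact: measurable_drift1.
- move=> z z' zz; apply: ge0_le_integral => //.
  + by move=> a _; exact: test_fun_ge0.
  + exact: measurable_drift1.
  + exact: measurable_drift1.
  + move=> a _; apply: phile => s; rewrite !tnth_mktuple.
    by rewrite ge_max !le_max lexx/= lerD2r zz orbT.
Qed.

Lemma test_serve_op sg phi : test_fun phi -> test_fun (serve_op sg phi).
Proof.
move=> tphi; have [mphi phi01 phile] := tphi; split.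
- have := @measurable_fun_fubini_tonelli_F _ _ _ _ R sg _ (measurable_serve_fun mphi).
  by apply=> z; exact: test_fun_ge0.
- move=> z; rewrite integral_ge0/=; last by move=> a _; exact: test_fun_ge0.
  by apply: integral_le1 => //; exact: measurable_serve1.
- move=> z z' zz; apply: ge0_le_integral => //.
  + by move=> a _; exact: test_fun_ge0.
  + exact: measurable_serve1.
  + exact: measurable_serve1.
  + by move=> a _; apply: phile => s; rewrite !tnth_mktuple; exact: fstep_le.
Qed.

Lemma drift_drift (a b : R) z : 0 <= a -> drift a (drift b z) = drift (b + a) z.
Proof.
move=> a0; apply: eq_from_tnth => s; rewrite !tnth_mktuple.
by rewrite -max0_sub// opprD addrA.
Qed.

Lemma drift_op_thinning e e' (lam p : R) phi z : 0 < lam -> 0 < p -> p <= 1 ->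
  is_exp e lam -> is_exp e' (lam * p) -> test_fun phi ->
  (drift_op e' phi z =
   p%:E * drift_op e phi z + (1 - p)%:E * drift_op e' (drift_op e phi) z)%E.
Proof.
move=> l0 p0 p1 he he' tphi; have [mphi phi01 phile] := tphi.
rewrite /drift_op (exp_thinning l0 p0 p1 he he'); last 2 first.
- exact: measurable_drift1.
- by move=> a; exact: test_fun_ge0.
congr (_ + _ * _)%E; apply: eq_integral => b _.
(* Successive drifts add up only if the second length is nonnegative, which holds almost surely
   under [e]. *)
apply: ge0_ae_eq_integral => //.
- apply: (measurableT_comp mphi); apply: measurable_drift => //.
  exact: measurable_funD.
- exact: measurable_drift1.
- by move=> a _; exact: test_fun_ge0.
- by move=> a _; exact: test_fun_ge0.
- apply: filterS (is_exp_ae he) => a a0 _.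
  by rewrite drift_drift.
Qed.

End Operators.

(** * One-step recursion for the thinned workload *)

Section Steps.
Context (R : realType) (k n t : nat) (M : fj_input R k n) (lam mu : R).
Variables (sys : 'I_k -> 'I_n) (rec : 'I_k -> 'I_t -> {set 'I_n}) (i : 'I_k).
Hypothesis HM : fj_base M lam mu.
Local Notation P := (fji_P M).
Local Notation T := (fji_T M).

Definition thinned_rv m (w : T) : n.-tuple R :=
  thinned sys rec i (fun j => fji_A M j w) (fun j => fji_O M j w)
    (fun j s => fji_S M j s w) m.

(** The inputs that determine [thinned_rv m]; interarrival time [m] is among them because the
    workload is read on the arrival of request [m]. *)
Definition past m : pred (fj_index n) := fun x =>
  match x with
  | inl (inl j) => (j <= m)%N
  | inl (inr j) => (j < m)%N
  | inr (j, _) => (j < m)%N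
  end.

Definition present m : pred (fj_index n) := fun x =>
  match x with
  | inl (inl _) => false
  | inl (inr j) => j == m
  | inr (j, _) => j == m
  end.

Definition served m (w : T) := if fji_O M m w == i then
  serve sys rec i (thinned_rv m w) (services M id m w) else thinned_rv m w.

Lemma services_block (J : pred (fj_index n)) m : (forall s, J (inr (m, s))) ->
  measurable_fun setT (services M id m : block M J -> n.-tuple R).
Proof. by move=> Jm; apply: measurable_mktuple => s; exact: block_S. Qed.

Lemma served_block (J : pred (fj_index n)) m : J (inl (inr m)) -> (forall s, J (inr (m, s))) ->
  measurable_fun setT (thinned_rv m : block M J -> n.-tuple R) ->
  measurable_fun setT (served m : block M J -> n.-tuple R).
Proof.
move=> JO JS mX.
pose f j (w : block M J) := if j == i then serve sys rec i (thinned_rv m w) (services M id m w)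
  else thinned_rv m w.
refine (@measurable_case _ (block M J) k _ _ (fji_O M m : block M J -> 'I_k) f _ _).
  by move=> B; exact: block_O.
move=> j; rewrite /f; case: (j == i) => //.
by apply: measurable_serve => //; exact: services_block.
Qed.

Lemma thinned_block (J : pred (fj_index n)) m : (forall x, past m x -> J x) ->
  measurable_fun setT (thinned_rv m : block M J -> n.-tuple R).
Proof.
elim: m => [|m IH] Jm; first exact: measurable_cst.
apply: (@measurable_drift R _ (block M J) n (fji_A M m.+1 : block M J -> R) (served m)).
  by apply: block_A; apply: Jm => /=.
apply: served_block.
- by apply: Jm => /=.
- by move=> s; apply: Jm => /=.
- apply: IH => -[[j|j]|[j s]] /= jm; apply: Jm => /=; exact: leqW.
Qed.

Lemma measurable_thinned m : measurable_fun setT (thinned_rv m).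
Proof. by apply: (block_measurable HM (J := past m)); exact: thinned_block. Qed.

Lemma object_services_law m (B : set 'I_k) (q : R) (sg : probability (n.-tuple R) R) F :
  (forall F, measurable F -> P (services M id m @^-1` F) = sg F) ->
  P (fji_O M m @^-1` B) = q%:E -> measurable F ->
  P (fji_O M m @^-1` B `&` services M id m @^-1` F) = (q%:E * sg F)%E.
Proof.
move=> hsg hq mF.
rewrite (@blocks_indep _ _ _ _ _ _ HM (pred1 (inl (inr m) : fj_index n))
  (fun x : fj_index n => if x is inr (j, _) then j == m else false)).
- by rewrite hq hsg.
- by move=> x /= /eqP ->.
- by apply: block_O; rewrite /= eqxx.
- rewrite -[X in measurable X]setTI; exact: services_block mF.
Qed.

(** The interarrival time [m.+1] is independent of the workload left by request [m] and is
    integrated out first. What remains is split on whether request [m] asks for [f_i]; if so, its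
    services, independent of the past, are integrated out under [sg]. *)
Lemma thinned_step m phi (q : R) (e : probability R R) (sg : probability (n.-tuple R) R) :
  test_fun phi -> is_exp e lam ->
  (forall F, measurable F -> P (services M id m @^-1` F) = sg F) ->
  P [set w | fji_O M m w = i] = q%:E ->
  (\int[P]_w phi (thinned_rv m.+1 w) =
   q%:E * \int[P]_w serve_op sys rec i sg (drift_op e phi) (thinned_rv m w) +
   (1 - q)%:E * \int[P]_w drift_op e phi (thinned_rv m w))%E.
Proof.
move=> tphi he hsg hq; have [mphi phi01 phile] := tphi.
have tD := test_drift_op e tphi; have [mD D01 Dle] := tD.
have mO B : measurable (fji_O M m @^-1` B : set T) by have [_ []] := HM.
have q0 : 0 <= q by rewrite -lee_fin -hq.
have hq' : P (fji_O M m @^-1` (~` [set i])) = (1 - q)%:E.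
  by rewrite -preimage_setC probability_setC ?EFinB -?hq//; exact: mO.
have q1 : 0 <= 1 - q by rewrite -lee_fin -hq'.
pose f1 (za : n.-tuple R * R) := phi (drift za.2 za.1).
transitivity (\int[P]_w drift_op e phi (served m w))%E.
  apply: (@block_integral _ _ _ _ _ _ HM _ _ _ _
    (fun x => past m x || present m x) (pred1 (inl (inl m.+1) : fj_index n)) _
    (served m) (fji_A M m.+1) e f1).
  - by move=> [[j|j]|[j s]] //= /orP[jm|//]; apply/eqP => -[jm1]; rewrite jm1 ltnn in jm.
  - apply: served_block => /=.
    + by rewrite eqxx orbT.
    + by move=> s; rewrite eqxx orbT.
    + by apply: thinned_block => x ->.
  - by apply: block_A; rewrite /= eqxx.
  - move=> F mF; rewrite -(lawE P (measurable_A HM m.+1)).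
    exact: is_exp_unique (A_law HM m.+1) he F mF.
  - exact: measurable_drift_fun.
  - by move=> z; exact: test_fun_ge0.
have mserved : measurable_fun setT (served m).
  apply: (block_measurable HM (J := fun x => past m x || present m x)).
  apply: served_block => /=.
  + by rewrite eqxx orbT.
  + by move=> s; rewrite eqxx orbT.
  + by apply: thinned_block => x ->.
rewrite -[in LHS](setUv (fji_O M m @^-1` [set i])).
rewrite (@ge0_integral_setU _ _ _ P _ _ (mO _) (measurableC (mO _))); last 3 first.
- by rewrite setUv; exact: (measurableT_comp mD mserved).
- by move=> w _; exact: test_fun_ge0.
- by rewrite disj_set2E setICr.
have disj x : past m x -> ~~ present m x.
  by case: x => [[j|j]|[j s]] //= jm; rewrite neq_ltn jm.
have bO B : measurable (fji_O M m @^-1` B : set (block M (present m))).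
  by apply: block_O => /=.
have bS : measurable_fun setT (services M id m : block M (present m) -> n.-tuple R).
  by apply: services_block => s /=.
congr (_ + _)%E.
- rewrite (eq_integral (fun w => drift_op e phi (serve sys rec i (thinned_rv m w) (services M id m w)))); last first.
    by move=> w; rewrite inE /served => /= ->; rewrite eqxx.
  apply: (@block_integral_on _ _ _ _ _ _ HM _ _ _ _ (past m) (present m) disj
    (thinned_rv m) (services M id m) (fji_O M m @^-1` [set i]) sg q
    (fun ys => drift_op e phi (serve sys rec i ys.1 ys.2))) => //.
  - exact: thinned_block.
  - by move=> F mF; exact: object_services_law.
  - exact: measurable_serve_fun.
  - by move=> z; exact: test_fun_ge0.
- rewrite (eq_integral (fun w => drift_op e phi (thinned_rv m w))); last first.
    by move=> w; rewrite inE /served => /= /eqP /negbTE ->.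
  rewrite (@block_integral_on _ _ _ _ _ _ HM _ _ _ _ (past m) (present m) disj
    (thinned_rv m) (services M id m) (fji_O M m @^-1` (~` [set i])) sg (1 - q)
    (fun ys => drift_op e phi ys.1)) => //.
  - congr (_ * _)%E; apply: eq_integral => w _ /=.
    by rewrite integral_cst//= [X in (_ * X)%E](@probability_setT _ _ _ sg) mule1.
  - exact: thinned_block.
  - by move=> F mF; exact: object_services_law.
  - exact: (measurableT_comp mD).
  - by move=> z; exact: test_fun_ge0.
Qed.

End Steps.
Arguments thinned_rv {R k n t} M sys rec i m w.

Lemma measurable_tail (R : realType) (d : measure_display) (T : measurableType d)
    (X : T -> R) (x : R) : measurable_fun setT X ->
  measurable [set w | x < X w].
Proof.
move=> mX; rewrite (_ : mkset _ = X @^-1` `]x, +oo[%classic).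
  by rewrite -[X in measurable X]setTI; exact: mX.
by apply/seteqP; split => w /=; rewrite in_itv/= andbT.
Qed.

(** * Almost sure nonnegativity of the inputs and measurability of the download times *)

Section AlmostSure.
Context (R : realType) (k n t : nat) (M : fj_input R k n) (lam mu : R).
Variables (sys : 'I_k -> 'I_n) (rec : 'I_k -> 'I_t -> {set 'I_n}).
Hypothesis HM : fj_base M lam mu.
Local Notation P := (fji_P M).
Local Notation T := (fji_T M).

Definition nonneg_inputs (w : T) :=
  (forall m, 0 <= fji_A M m w) /\ (forall m s, 0 <= fji_S M m s w).

Lemma ae_nonneg_inputs : {ae P, forall w, nonneg_inputs w}.
Proof.
have aeA : {ae P, forall w, forall m, 0 <= fji_A M m w}.
  apply/ae_foralln => m; exists [set w | ~ (0 <= fji_A M m w)]; split => //.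
    rewrite (_ : mkset _ = fji_A M m @^-1` `]-oo, 0[%classic).
      by rewrite -[X in measurable X]setTI; exact: (measurable_A HM).
    by apply/seteqP; split => w /=; rewrite in_itv/= ltNge => /negP.
  exact: (A_ge0 HM).
have aeS : {ae P, forall w, forall m s, 0 <= fji_S M m s w}.
  apply/ae_foralln => m; apply: filter_forall => s.
  exists [set w | ~ (0 <= fji_S M m s w)]; split => //.
    rewrite (_ : mkset _ = fji_S M m s @^-1` `]-oo, 0[%classic).
      by rewrite -[X in measurable X]setTI; exact: (measurable_S HM).
    by apply/seteqP; split => w /=; rewrite in_itv/= ltNge => /negP.
  exact: (S_ge0 HM).
by apply: filterS2 aeA aeS => w.
Qed.

(** Sample-path inequalities need nonnegative inputs; this turns them into inequalities between
    probabilities. *)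
Lemma le_nonneg_inputs (B C : set T) : measurable B -> measurable C ->
  (forall w, nonneg_inputs w -> B w -> C w) -> (P B <= P C)%E.
Proof.
move=> mB mC BC; have [N [mN N0 hN]] := ae_nonneg_inputs.
apply: (@le_trans _ _ (P (C `|` N))).
  apply: le_measure; rewrite ?inE//; first exact: measurableU.
  move=> w Bw; have [Nw|nNw] := pselect (N w); [by right|left].
  by apply: BC Bw; apply: contrapT => nw; apply: nNw; exact: hN.
apply: (le_trans (measureU2 _ mC mN)).
by rewrite [X in (_ + X)%E]N0 adde0.
Qed.

Lemma measurable_arrival m : measurable_fun setT (fun w => arrival (fun j => fji_A M j w) m).
Proof. by apply: measurable_sum => j; exact: (measurable_A HM). Qed.

Lemma measurable_free m s : measurable_fun setT (fun w =>
  fj_free sys rec (fun j => fji_A M j w) (fun j => fji_O M j w) (fun j s => fji_S M j s w) m s).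
Proof.
elim: m s => [|m IH] s; first exact: measurable_cst.
have mO : forall B, measurable (fji_O M m @^-1` B) by have [_ []] := HM.
apply: (measurable_case (f := fun o w => fj_free_step sys rec (fj_free sys rec
  (fun j => fji_A M j w) (fun j => fji_O M j w) (fun j s => fji_S M j s w) m)
  (arrival (fun j => fji_A M j w) m) o (fun s => fji_S M m s w) s) mO) => o.
apply: measurable_free_step => //; first exact: measurable_arrival.
by move=> s'; exact: (measurable_S HM).
Qed.

Lemma measurable_T_FJ m : measurable_fun setT (T_FJ sys rec M m).
Proof.
have mO : forall B, measurable (fji_O M m @^-1` B) by have [_ []] := HM.
apply: measurable_funB; last exact: measurable_arrival.
apply: (measurable_case (f := fun o w => fj_depart sys rec (fj_free sys rec
  (fun j => fji_A M j w) (fun j => fji_O M j w) (fun j s => fji_S M j s w) m)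
  (arrival (fun j => fji_A M j w) m) o (fun s => fji_S M m s w)) mO) => o.
apply: measurable_depart => //.
- by move=> s; exact: measurable_free.
- exact: measurable_arrival.
- by move=> s'; exact: (measurable_S HM).
Qed.

Lemma measurable_T_SM m : measurable_fun setT (T_SM sys rec M m).
Proof.
apply: measurable_funB; last exact: measurable_arrival.
have step m' (prev : T -> R) : measurable_fun setT prev ->
    measurable_fun setT (fun w => let b := Num.max (arrival (fun j => fji_A M j w) m') (prev w) in
      fj_depart sys rec (fun=> b) b (fji_O M m' w) (fun s => fji_S M m' s w)).
  move=> mp; have mO : forall B, measurable (fji_O M m' @^-1` B) by have [_ []] := HM.
  have mb : measurable_fun setT (fun w => Num.max (arrival (fun j => fji_A M j w) m') (prev w)).
    by apply: measurable_maxr => //; exact: measurable_arrival.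
  apply: (measurable_case (f := fun o w => let b := Num.max (arrival (fun j => fji_A M j w) m') (prev w) in
    fj_depart sys rec (fun=> b) b o (fun s => fji_S M m' s w)) mO) => o.
  apply: measurable_depart => //.
  by move=> s'; exact: (measurable_S HM).
elim: m => [|m IH]; first exact: (step 0%N (cst 0)).
exact: (step m.+1).
Qed.

End AlmostSure.

Section Tail.
Context (R : realType) (k n t : nat).
Variables (sys : 'I_k -> 'I_n) (rec : 'I_k -> 'I_t -> {set 'I_n}) (i : 'I_k).
Variable x : R.

Definition late : set (n.-tuple R * n.-tuple R) :=
  [set ys | x < fj_depart sys rec (tnth ys.1) 0 i (tnth ys.2)].

Lemma measurable_late : measurable late.
Proof.
apply: measurable_tail; apply: measurable_depart => // s.
- exact: (measurableT_comp (measurable_tnth s) measurable_fst).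
- exact: (measurableT_comp (measurable_tnth s) measurable_snd).
Qed.

(** The probability that the download takes longer than [x], given the workload [y] met on
    arrival. *)
Definition tail_fun (sg : probability (n.-tuple R) R) y := (\int[sg]_s (\1_late (y, s))%:E)%E.

Let mind : measurable_fun setT (fun ys => (\1_late ys)%:E : \bar R).
Proof. by apply/measurable_EFinP; apply: measurable_indic; exact: measurable_late. Qed.

Lemma test_tail_fun sg : test_fun (tail_fun sg).
Proof.
have ind0 ys : (0 <= (\1_late ys)%:E :> \bar R)%E by rewrite lee_fin.
have mind1 y : measurable_fun setT (fun s => (\1_late (y, s))%:E : \bar R).
  by apply: (measurableT_comp mind); exact: measurable_fun_pair.
split.
- exact: (@measurable_fun_fubini_tonelli_F _ _ _ _ R sg _ mind).
- move=> y; rewrite integral_ge0//=; apply: integral_le1 => // s.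
  by rewrite ind0 lee_fin indicE lern1 leq_b1.
- move=> y y' yy; apply: ge0_le_integral => // s _.
  rewrite lee_fin !indicE; have [/set_mem h|//] := boolP ((y, s) \in late).
  rewrite mem_set//; apply: (lt_le_trans h); exact: depart_le.
Qed.

(** The object and the services of request [m] are independent of the workload it meets and of each
    other. *)
Lemma tail_thinned (M : fj_input R k n) (lam mu : R) (HM : fj_base M lam mu) m (q : R)
    (sg : probability (n.-tuple R) R) :
  (forall F, measurable F -> fji_P M (services M id m @^-1` F) = sg F) ->
  fji_P M [set w | fji_O M m w = i] = q%:E ->
  (fji_P M ([set w | fji_O M m w = i] `&` [set w | late (thinned_rv M sys rec i m w, services M id m w)]) =
   q%:E * \int[fji_P M]_w tail_fun sg (thinned_rv M sys rec i m w))%E.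
Proof.
move=> hsg hq.
have mO B : measurable (fji_O M m @^-1` B : set (fji_T M)) by have [_ []] := HM.
have q0 : 0 <= q by rewrite -lee_fin -hq.
have mX := measurable_thinned sys rec i HM m.
have mS := measurable_services HM id m.
have mXS : measurable_fun setT (fun w => (thinned_rv M sys rec i m w, services M id m w)).
  exact: measurable_fun_pair.
rewrite -(@block_integral_on _ _ _ _ _ _ HM _ _ _ _ (past m) (@present n m) _
    (thinned_rv M sys rec i m) (services M id m) (fji_O M m @^-1` [set i]) sg q
    (fun ys => (\1_late ys)%:E)) => //.
- rewrite setIC.
  have mE : measurable [set w | late (thinned_rv M sys rec i m w, services M id m w)].
    by rewrite -[X in measurable X]setTI; apply: mXS => //; exact: measurable_late.
  rewrite -[LHS](@integral_indic _ _ _ (fji_P M) (fji_O M m @^-1` [set i]) (mO _) _ mE).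
  by apply: eq_integral => w _; rewrite !indicE.
- by case=> [[j|j]|[j s]] //= jm; rewrite neq_ltn jm.
- exact: thinned_block.
- by apply: services_block => s /=.
- by apply: block_O => /=.
- by move=> F mF; exact: (object_services_law HM).
Qed.

End Tail.

(** * Comparison with the fixed-object system *)

Section Compare.
Context (R : realType) (k n t : nat).
Variables (sys : 'I_k -> 'I_n) (rec : 'I_k -> 'I_t -> {set 'I_n}) (i : 'I_k).
Variables (M N : fj_input R k n) (lam mu p : R).
Hypotheses (lam0 : 0 < lam) (mu0 : 0 < mu) (p0 : 0 < p) (p1 : p <= 1).
Hypotheses (HM : fj_base M lam mu) (HN : fj_base N (lam * p) mu).
Hypotheses (OM : forall m, fji_P M [set w | fji_O M m w = i] = p%:E)
  (ON : forall m w, fji_O N m w = i).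
Implicit Types phi : n.-tuple R -> \bar R.

Variables (sg : probability (n.-tuple R) R) (e e' : probability R R).
Hypotheses (he : is_exp e lam) (he' : is_exp e' (lam * p))
  (services_M : forall m F, measurable F -> fji_P M (services M id m @^-1` F) = sg F)
  (services_N : forall m F, measurable F -> fji_P N (services N id m @^-1` F) = sg F).
Let X := thinned_rv M sys rec i.
Let Y := thinned_rv N sys rec i.
Notation J := (serve_op sys rec i sg).

Lemma object_N m : fji_P N [set w | fji_O N m w = i] = 1%:E.
Proof.
rewrite (_ : mkset _ = setT) ?probability_setT//.
by apply/seteqP; split => // w _; exact: ON.
Qed.

Definition meanM phi m : R := fine (\int[fji_P M]_w phi (X m w))%E.
Definition meanN phi m : R := fine (\int[fji_P N]_w phi (Y m w))%E.

Lemma test_comp (Q : fj_input R k n) lam' (HQ : fj_base Q lam' mu) phi m : test_fun phi ->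
  measurable_fun setT (fun w => phi (thinned_rv Q sys rec i m w)).
Proof. by move=> [mphi _ _]; apply: (measurableT_comp mphi); exact: (measurable_thinned sys rec i HQ m). Qed.

Lemma mean_fin (Q : fj_input R k n) lam' (HQ : fj_base Q lam' mu) phi m : test_fun phi ->
  (\int[fji_P Q]_w phi (thinned_rv Q sys rec i m w))%E \is a fin_num.
Proof.
move=> tphi; have := integral_le1 (fji_P Q) (test_comp HQ m tphi) _.
have [_ phi01 _] := tphi => /(_ (fun w => phi01 _)) le1.
rewrite ge0_fin_numE; first exact: le_lt_trans le1 (ltry 1).
by apply: integral_ge0 => w _; exact: test_fun_ge0.
Qed.

Lemma meanME phi m : test_fun phi -> (\int[fji_P M]_w phi (X m w) = (meanM phi m)%:E)%E.
Proof. by move=> tphi; rewrite /meanM fineK//; exact: (mean_fin HM). Qed.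

Lemma meanNE phi m : test_fun phi -> (\int[fji_P N]_w phi (Y m w) = (meanN phi m)%:E)%E.
Proof. by move=> tphi; rewrite /meanN fineK//; exact: (mean_fin HN). Qed.

Lemma meanM_ge0 phi m : test_fun phi -> 0 <= meanM phi m.
Proof.
by move=> tphi; rewrite fine_ge0//; apply: integral_ge0 => w _; exact: test_fun_ge0.
Qed.

Lemma meanN_le1 phi m : test_fun phi -> meanN phi m <= 1.
Proof.
move=> tphi; rewrite -lee_fin -(meanNE _ tphi); apply: integral_le1.
- exact: (test_comp HN).
- by move=> w; have [_ h _] := tphi.
Qed.

Lemma meanM_step phi m : test_fun phi ->
  meanM phi m.+1 = p * meanM (J (drift_op e phi)) m + (1 - p) * meanM (drift_op e phi) m.
Proof.
move=> tphi; apply: EFin_inj; have tD := test_drift_op e tphi.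
rewrite -(meanME _ tphi) (thinned_step sys rec HM tphi he (@services_M m) (OM m)).
by rewrite (meanME m tD) (meanME m (test_serve_op sys rec i sg tD)).
Qed.

Lemma meanN_step phi m : test_fun phi -> meanN phi m.+1 = meanN (J (drift_op e' phi)) m.
Proof.
move=> tphi; apply: EFin_inj; have tD := test_drift_op e' tphi.
rewrite -(meanNE _ tphi) (thinned_step sys rec HN tphi he' (@services_N m) (object_N m)).
by rewrite subrr mul0e adde0 mul1e (meanNE m (test_serve_op sys rec i sg tD)).
Qed.

Lemma serve_op_thinning phi y : test_fun phi ->
  (J (drift_op e' phi) y =
   p%:E * J (drift_op e phi) y + (1 - p)%:E * J (drift_op e' (drift_op e phi)) y)%E.
Proof.
move=> tphi; have tD := test_drift_op e tphi; have tDD := test_drift_op e' tD.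
have [mD _ _] := tD; have [mDD _ _] := tDD.
have p0' : (0 <= p%:E :> \bar R)%E by rewrite lee_fin ltW.
have q0' : (0 <= (1 - p)%:E :> \bar R)%E by rewrite lee_fin subr_ge0.
have m1 := measurable_serve1 sys rec i y mD.
have m2 := measurable_serve1 sys rec i y mDD.
have g1 s : setT s -> (0 <= drift_op e phi (serve sys rec i y s))%E.
  by move=> _; exact: test_fun_ge0 tD.
have g2 s : setT s -> (0 <= drift_op e' (drift_op e phi) (serve sys rec i y s))%E.
  by move=> _; exact: test_fun_ge0 tDD.
rewrite !serve_opE -(ge0_integralZl sg measurableT m1 g1 p0').
rewrite -(ge0_integralZl sg measurableT m2 g2 q0').
rewrite -(ge0_integralD sg measurableT (fun s h => mule_ge0 p0' (g1 s h))
  (measurable_funeM _ m1) (fun s h => mule_ge0 q0' (g2 s h)) (measurable_funeM _ m2)).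
apply: eq_integral => s _.
exact: (drift_op_thinning _ lam0 p0 p1 he he' tphi).
Qed.

(** After [serve_op_thinning], the term with an additional idle period of rate [lam] is by
    [meanN_step] again a mean after [m.+1] arrivals. Hence the index does not drop there: such a
    period ends without a request for [f_i]. *)
Lemma meanN_thinning phi m : test_fun phi ->
  meanN phi m.+1 = p * meanN (J (drift_op e phi)) m + (1 - p) * meanN (drift_op e phi) m.+1.
Proof.
move=> tphi; have tD := test_drift_op e tphi; have tDD := test_drift_op e' tD.
have tJD := test_serve_op sys rec i sg tD; have tJDD := test_serve_op sys rec i sg tDD.
rewrite (meanN_step m tphi) (meanN_step m tD); apply: EFin_inj.
rewrite -(meanNE m (test_serve_op sys rec i sg (test_drift_op e' tphi))).
rewrite (eq_integral (fun w => p%:E * J (drift_op e phi) (Y m w) +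
  (1 - p)%:E * J (drift_op e' (drift_op e phi)) (Y m w))%E); last first.
  by move=> w _; exact: serve_op_thinning.
have p0' : (0 <= p%:E :> \bar R)%E by rewrite lee_fin ltW.
have q0' : (0 <= (1 - p)%:E :> \bar R)%E by rewrite lee_fin subr_ge0.
have m1 := test_comp HN m tJD; have m2 := test_comp HN m tJDD.
have g1 w : setT w -> (0 <= J (drift_op e phi) (Y m w))%E.
  by move=> _; exact: test_fun_ge0 tJD.
have g2 w : setT w -> (0 <= J (drift_op e' (drift_op e phi)) (Y m w))%E.
  by move=> _; exact: test_fun_ge0 tJDD.
rewrite (ge0_integralD (fji_P N) measurableT (fun s h => mule_ge0 p0' (g1 s h))
  (measurable_funeM _ m1) (fun s h => mule_ge0 q0' (g2 s h)) (measurable_funeM _ m2)).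
rewrite (ge0_integralZl (fji_P N) measurableT m1 g1 p0').
rewrite (ge0_integralZl (fji_P N) measurableT m2 g2 q0').
by rewrite (meanNE m tJD) (meanNE m tJDD).
Qed.

Lemma thinned_rv_ge0 m w s : 0 <= tnth (X m w) s.
Proof.
by case: m => [|m]; rewrite /X /thinned_rv /= tnth_mktuple// le_max lexx.
Qed.

(* 2^K (1 - p/2)^m dominates the probability that a binomial(m,p) variable is
   below K; it satisfies the same recursion b(m+1,K+1) = p b(m,K) + (1-p) b(m,K+1). *)
Lemma mean_compare m K phi : test_fun phi ->
  meanN phi K <= meanM phi m + 2 ^+ K * (1 - p / 2) ^+ m.
Proof.
have r0 : 0 <= 1 - p / 2 by rewrite subr_ge0 ler_pdivrMr// mul1r (le_trans p1)// ler1n.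
have b0 a b : 0 <= 2 ^+ a * (1 - p / 2) ^+ b by rewrite mulr_ge0// exprn_ge0.
elim: m K phi => [|m IH] [|K] phi tphi.
- apply: (le_trans (meanN_le1 _ tphi)); rewrite !expr0 mulr1 lerDr; exact: meanM_ge0.
- apply: (le_trans (meanN_le1 _ tphi)); rewrite expr0 mulr1.
  by rewrite -[leLHS]add0r lerD ?meanM_ge0// exprn_ege1// ler1n.
(* Case [K = 0]: the fixed-object system starts empty, below every workload of the thinned
   system. *)
- apply: (@le_trans _ _ (meanM phi m.+1)); last by rewrite lerDl.
  rewrite -lee_fin -(meanNE _ tphi) -(meanME _ tphi).
  have [mphi _ phile] := tphi.
  rewrite (eq_integral (cst (phi [tuple 0 | _ < n]))); last by [].
  rewrite integral_cst//= [X in (_ * X)%E](@probability_setT _ _ _ (fji_P N)) mule1.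
  rewrite -[leLHS]mule1 -(@probability_setT _ _ _ (fji_P M)) -integral_cst//.
  apply: ge0_le_integral => //.
  + by move=> w _; exact: test_fun_ge0.
  + exact: (test_comp HM).
  + by move=> w _; apply: phile => s; rewrite tnth_mktuple; exact: thinned_rv_ge0.
- rewrite (meanN_thinning K tphi) (meanM_step m tphi).
  have tD := test_drift_op e tphi.
  have h1 := IH K _ (test_serve_op sys rec i sg tD).
  have h2 := IH K.+1 _ tD.
  have := lerD (ler_wpM2l (ltW p0) h1) (ler_wpM2l (_ : 0 <= 1 - p) h2).
  rewrite subr_ge0 => /(_ p1) /le_trans; apply.
  rewrite !exprS; set u := 2 ^+ K; set v := _ ^+ m.
  (* The error terms match exactly, since [p / 2 + (1 - p) = 1 - p / 2]. *)
  rewrite le_eqVlt; apply/orP; left; apply/eqP; by field.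
Qed.

(** A joint probability, not a conditional one, so that summing over [i] gives a tail by total
    probability. *)
Definition tailM (x : R) m : R := fine (fji_P M ([set w | fji_O M m w = i] `&`
  [set w | late sys rec i x (thinned_rv M sys rec i m w, services M id m w)])).

Lemma tail_compare_law x m K :
  p * fine (fji_P N [set w | x < T_FJ sys rec N K w]) <=
  tailM x m + p * (2 ^+ K * (1 - p / 2) ^+ m).
Proof.
have tt := test_tail_fun sys rec i x sg.
have -> : tailM x m = p * meanM (tail_fun sys rec i x sg) m.
  rewrite /tailM (tail_thinned sys rec x HM (@services_M m) (OM m)).
  by rewrite (meanME m tt).
rewrite -mulrDr ler_pM2l//; apply: le_trans (mean_compare m K tt).
rewrite -lee_fin -(meanNE _ tt).
have := tail_thinned sys rec x HN (@services_N K) (object_N K).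
rewrite mul1e => <-.
have mX := measurable_thinned sys rec i HN K.
have mS := measurable_services HN id K.
rewrite fineK ?fin_num_measure//; last first.
  by apply: measurable_tail; exact: (measurable_T_FJ sys rec HN K).
apply: (le_nonneg_inputs HN).
- by apply: measurable_tail; exact: (measurable_T_FJ sys rec HN K).
- apply: measurableI; first by have [_ [h _ _ _ _]] := HN; exact: (h K [set i]).
  rewrite -[X in measurable X]setTI.
  by apply: (measurable_fun_pair mX mS) => //; exact: measurable_late.
move=> w [A0 _] /=; rewrite /T_FJ (download_thinned _ _ _ A0 _ (i := i))//.
by move=> h; split => //; rewrite /late/= tnth_mktupleE.
Qed.

End Compare.

Lemma tail_compare (R : realType) (k n t : nat) (sys : 'I_k -> 'I_n)
    (rec : 'I_k -> 'I_t -> {set 'I_n}) (i : 'I_k) (M N : fj_input R k n) (lam mu p : R) :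
  0 < lam -> 0 < mu -> 0 < p -> p <= 1 -> fj_base M lam mu -> fj_base N (lam * p) mu ->
  (forall m, fji_P M [set w | fji_O M m w = i] = p%:E) ->
  (forall m w, fji_O N m w = i) -> forall x m K,
  p * fine (fji_P N [set w | x < T_FJ sys rec N K w]) <=
  tailM sys rec i M x m + p * (2 ^+ K * (1 - p / 2) ^+ m).
Proof.
move=> lam0 mu0 p0 p1 HM HN OM ON x m K.
apply: (tail_compare_law sys rec lam0 p0 p1 HM HN OM ON (A_law HM 0) (A_law HN 0)
  (sg := law (fji_P M) (measurable_services HM id 0))) => j F mF;
  rewrite (lawE (fji_P M) (measurable_services HM id 0)).
- exact: (services_law HM HM mu0 j 0 (@inj_id _) (@inj_id _) mF).
- exact: (services_law HN HM mu0 j 0 (@inj_id _) (@inj_id _) mF).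
Qed.

(** * Sojourn times of single-server queues *)

Lemma block_sub (R : realType) (k n : nat) (M : fj_input R k n) (J J' : pred (fj_index n))
    (d : measure_display) (V : measurableType d) (f : fji_T M -> V) :
  (forall x, J x -> J' x) -> measurable_fun setT (f : block M J -> V) ->
  measurable_fun setT (f : block M J' -> V).
Proof.
move=> JJ mf _ B mB; have /(_ measurableT B mB) := mf.
apply: smallest_sub; first exact: smallest_sigma_algebra.
move=> C [s [E [us sJ sE ->]]]; apply: sub_sigma_algebra.
by exists s, E; split => // j /sJ; exact: JJ.
Qed.

Section Lindley.
Context (R : realType) (k n : nat) (M : fj_input R k n) (lam mu : R).
Hypothesis HM : fj_base M lam mu.
Local Notation P := (fji_P M).
Local Notation T := (fji_T M).
Variables (V : nat -> T -> R) (dl e : probability R R).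
Hypotheses (bV : forall m, measurable_fun setT (V m : block M (@present n m) -> R))
  (Vdl : forall m F, measurable F -> P (V m @^-1` F) = dl F) (he : is_exp e lam).

Definition lindley_rv m (w : T) := lindley (fun j => fji_A M j w) (fun j => V j w) m.

Definition upto m : pred (fj_index n) := fun x => @past n m x || @present n m x.

Lemma lindley_block (J : pred (fj_index n)) m : (forall x, upto m x -> J x) ->
  measurable_fun setT (lindley_rv m : block M J -> R).
Proof.
elim: m => [|m IH] Jm.
  by refine (@block_sub _ _ _ _ _ J _ _ (V 0%N) _ (@bV 0%N)) => x hx; apply: Jm; rewrite /upto hx orbT.
apply: (@measurable_funD _ (block M J) _ _ (fun w => Num.max 0 (lindley_rv m w - fji_A M m.+1 w)) (V m.+1)).
- apply: measurable_maxr => //; apply: measurable_funB.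
    apply: IH => x ux; apply: Jm; move: ux.
    case: x => [[j|j]|[j s]]; rewrite /upto /= ?orbF; first exact: leqW.
    + by rewrite orbC -leq_eqVlt ltnS => ->.
    + by rewrite orbC -leq_eqVlt ltnS => ->.
  by apply: block_A; apply: Jm; rewrite /upto /= leqnn.
- by refine (@block_sub _ _ _ _ _ J _ _ (V m.+1) _ (@bV m.+1)) => x hx; apply: Jm; rewrite /upto hx orbT.
Qed.

Lemma measurable_lindley m : measurable_fun setT (lindley_rv m).
Proof. by apply: (block_measurable HM (J := upto m)); exact: lindley_block. Qed.

Let sum_op (phi : R -> \bar R) (zv : R * R) := phi (zv.1 + zv.2).
Let sojourn_op (phi : R -> \bar R) (la : R * R) :=
  (\int[dl]_v phi (Num.max 0 (la.1 - la.2) + v)%R)%E.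

Lemma measurable_sum_op phi : measurable_fun setT phi -> measurable_fun setT (sum_op phi).
Proof. by move=> mphi; apply: (measurableT_comp mphi); exact: measurable_funD. Qed.

Lemma measurable_sojourn_op phi : measurable_fun setT phi -> (forall z, 0 <= phi z)%E ->
  measurable_fun setT (sojourn_op phi).
Proof.
move=> mphi phi0.
apply: (@measurable_fun_fubini_tonelli_F _ _ _ _ R dl
  (fun lav : (R * R) * R => phi (Num.max 0 (lav.1.1 - lav.1.2) + lav.2)%R)); last by [].
apply: (measurableT_comp mphi); apply: measurable_funD => //.
apply: measurable_maxr => //; apply: measurable_funB.
- exact: (measurableT_comp measurable_fst measurable_fst).
- exact: (measurableT_comp measurable_snd measurable_fst).
Qed.

Lemma lindley_step phi m : measurable_fun setT phi -> (forall z, 0 <= phi z)%E ->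
  (\int[P]_w phi (lindley_rv m.+1 w) =
   \int[P]_w \int[e]_a \int[dl]_v phi (Num.max 0 (lindley_rv m w - a) + v)%R)%E.
Proof.
move=> mphi phi0.
transitivity (\int[P]_w sojourn_op phi (lindley_rv m w, fji_A M m.+1 w))%E.
  apply: (@block_integral _ _ _ _ _ _ HM _ _ _ _ (@past n m.+1) (@present n m.+1) _
    (fun w => Num.max 0 (lindley_rv m w - fji_A M m.+1 w)) (V m.+1) dl (sum_op phi)).
  - by case=> [[j|j]|[j s]] //= jm; rewrite neq_ltn jm.
  - apply: measurable_maxr => //; apply: measurable_funB.
      apply: lindley_block => -[[j|j]|[j s]]; rewrite /upto /= ?orbF.
      + exact: leqW.
      + by rewrite orbC -leq_eqVlt ltnS.
      + by rewrite orbC -leq_eqVlt ltnS.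
    by apply: block_A => /=.
  - exact: bV.
  - exact: Vdl.
  - exact: measurable_sum_op.
  - by move=> z; exact: phi0.
apply: (@block_integral _ _ _ _ _ _ HM _ _ _ _ (upto m) (pred1 (inl (inl m.+1) : fj_index n)) _
    (lindley_rv m) (fji_A M m.+1) e (sojourn_op phi)).
- move=> [[j|j]|[j s]]; rewrite /upto //= orbF => jm.
  by apply/eqP => -[jm1]; rewrite jm1 ltnn in jm.
- exact: lindley_block.
- by apply: block_A; rewrite /= eqxx.
- move=> F mF; rewrite -(lawE P (measurable_A HM m.+1)).
  exact: is_exp_unique (A_law HM m.+1) he F mF.
- exact: measurable_sojourn_op.
- by move=> z; apply: integral_ge0 => v _; exact: phi0.
Qed.

(** Tonelli puts the service time outermost, so that the lower bound below can be split according to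
    whether the service alone exceeds the level. *)
Lemma lindley_step_swap phi m : measurable_fun setT phi -> (forall z, 0 <= phi z)%E ->
  (\int[P]_w phi (lindley_rv m.+1 w) =
   \int[dl]_v \int[e]_a \int[P]_w phi (Num.max 0 (lindley_rv m w - a) + v)%R)%E.
Proof.
move=> mphi phi0; rewrite lindley_step//.
have mL := measurable_lindley m.
transitivity (\int[e]_a \int[P]_w \int[dl]_v phi (Num.max 0 (lindley_rv m w - a) + v)%R)%E.
  apply: (@fubini_tonelli _ _ _ _ _ P e (fun wa : T * R => sojourn_op phi (lindley_rv m wa.1, wa.2))).
  - apply: (measurableT_comp (measurable_sojourn_op mphi phi0)).
    by apply: measurable_fun_pair => //; exact: (measurableT_comp mL).
  - by move=> z; apply: integral_ge0 => v _; exact: phi0.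
rewrite (eq_integral (fun a : R => \int[dl]_v \int[P]_w phi (Num.max 0 (lindley_rv m w - a) + v)%R)%E); last first.
  move=> a _.
  apply: (@fubini_tonelli _ _ _ _ _ P dl (fun wv : T * R => phi (Num.max 0 (lindley_rv m wv.1 - a) + wv.2)%R)) => //.
  apply: (measurableT_comp mphi); apply: measurable_funD => //.
  apply: measurable_maxr => //; apply: measurable_funB => //.
  exact: (measurableT_comp mL).
apply: (@fubini_tonelli _ _ _ _ _ e dl (fun av : R * R => \int[P]_w phi (Num.max 0 (lindley_rv m w - av.1) + av.2)%R)%E) => //.
- apply: (@measurable_fun_fubini_tonelli_F _ _ _ _ R P
    (fun avw : (R * R) * T => phi (Num.max 0 (lindley_rv m avw.2 - avw.1.1) + avw.1.2)%R)); last by [].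
  apply: (measurableT_comp mphi); apply: measurable_funD.
    apply: measurable_maxr => //; apply: measurable_funB.
      exact: (measurableT_comp mL).
    exact: (measurableT_comp measurable_fst measurable_fst).
  exact: (measurableT_comp measurable_snd measurable_fst).
- by move=> z; apply: integral_ge0 => w _; exact: phi0.
Qed.

End Lindley.
Arguments lindley_rv {R k n} M V m w.

(** Induction on [m] for all [phi] at once, because one step replaces [phi] by its average over an
    interarrival time and a service. *)
Lemma lindley_law (R : realType) (k n : nat) (M M' : fj_input R k n) (lam mu : R)
    (HM : fj_base M lam mu) (HM' : fj_base M' lam mu)
    (V : nat -> fji_T M -> R) (V' : nat -> fji_T M' -> R) (dl : probability R R) :
  (forall m, measurable_fun setT (V m : block M (@present n m) -> R)) ->
  (forall m, measurable_fun setT (V' m : block M' (@present n m) -> R)) ->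
  (forall m F, measurable F -> fji_P M (V m @^-1` F) = dl F) ->
  (forall m F, measurable F -> fji_P M' (V' m @^-1` F) = dl F) ->
  forall m phi, measurable_fun setT phi -> (forall z, 0 <= phi z)%E ->
  (\int[fji_P M]_w phi (lindley_rv M V m w) =
   \int[fji_P M']_w phi (lindley_rv M' V' m w))%E.
Proof.
move=> bV bV' Vdl Vdl'.
have he := A_law HM 0; set e := law _ _ in he.
elim=> [|m IH] phi mphi phi0.
  have base (Q : fj_input R k n) (HQ : fj_base Q lam mu) (U : nat -> fji_T Q -> R)
      (bU : forall m, measurable_fun setT (U m : block Q (@present n m) -> R))
      (Udl : forall m F, measurable F -> fji_P Q (U m @^-1` F) = dl F) :
      (\int[fji_P Q]_w phi (lindley_rv Q U 0 w) = \int[dl]_v phi v)%E.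
    have mU := block_measurable HQ (bU 0%N).
    rewrite -(ge0_integral_law (fji_P Q) mU mphi phi0).
    by apply: eq_measure_integral => A mA _; exact: Udl.
  by rewrite (base M)// (base M').
rewrite (lindley_step HM bV Vdl he)// (lindley_step HM' bV' Vdl' he)//.
apply: (IH (fun l => \int[e]_a \int[dl]_v phi (Num.max 0 (l - a) + v)%R)%E).
- apply: (@measurable_fun_fubini_tonelli_F _ _ _ _ R e
    (fun la : R * R => \int[dl]_v phi (Num.max 0 (la.1 - la.2) + v)%R)%E).
    exact: measurable_sojourn_op.
  by move=> z; apply: integral_ge0 => v _; exact: phi0.
- by move=> z; apply: integral_ge0 => a _; apply: integral_ge0 => v _; exact: phi0.
Qed.

(** * Exponential lower bound on the sojourn tail *)

Section LowerBound.
Context (R : realType) (k n : nat) (M : fj_input R k n) (lam mu nu th : R).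
Hypothesis HM : fj_base M lam mu.
Local Notation P := (fji_P M).
Local Notation T := (fji_T M).
Variables (V : nat -> T -> R) (dl e : probability R R).
Hypotheses (bV : forall m, measurable_fun setT (V m : block M (@present n m) -> R))
  (Vdl : forall m F, measurable F -> P (V m @^-1` F) = dl F)
  (he : is_exp e lam) (hdl : is_exp dl nu).
Hypotheses (lam0 : 0 < lam) (th0 : 0 < th) (thnu : th < nu) (thlam : nu - lam <= th).
Notation L := (lindley_rv M V).

Let nu0 : 0 < nu. Proof. exact: lt_trans thnu. Qed.

Let mL m : measurable_fun setT (L m). Proof. exact: (measurable_lindley HM bV). Qed.

Definition exceed m (x v a : R) := P [set w | x < Num.max 0 (L m w - a) + v].

Lemma measurable_exceed_set m (x v a : R) :
  measurable [set w | x < Num.max 0 (L m w - a) + v].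
Proof.
apply: measurable_tail; apply: measurable_funD => //; apply: measurable_maxr => //.
exact: measurable_funB.
Qed.

Lemma exceedE m (x v a : R) :
  (\int[P]_w (\1_(`]x, +oo[%classic) (Num.max 0 (L m w - a) + v)%R)%:E)%E = exceed m x v a.
Proof.
rewrite /exceed -[X in _ = P X]setIT -integral_indic//; last exact: measurable_exceed_set.
by apply: eq_integral => w _; rewrite !indicE; congr (_%:R)%:E; congr nat_of_bool;
  apply/idP/idP; rewrite !inE/= in_itv/= andbT.
Qed.

Lemma measurable_exceed m x :
  measurable_fun setT (fun va : R * R => exceed m x va.1 va.2).
Proof.
rewrite (_ : (fun _ => _) = (fun va : R * R =>
  \int[P]_w (\1_(`]x, +oo[%classic) (Num.max 0 (L m w - va.2) + va.1)%R)%:E)%E); last first.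
  by apply/funext => va; rewrite exceedE.
apply: (@measurable_fun_fubini_tonelli_F _ _ _ _ R P (fun vaw : (R * R) * T =>
  (\1_(`]x, +oo[%classic) (Num.max 0 (L m vaw.2 - vaw.1.2) + vaw.1.1)%R)%:E)); last first.
  by move=> z; rewrite lee_fin.
apply/measurable_EFinP; apply: measurableT_comp => //.
apply: measurable_funD; last exact: (measurableT_comp measurable_fst measurable_fst).
apply: measurable_maxr => //; apply: measurable_funB; first exact: (measurableT_comp (mL m)).
exact: (measurableT_comp measurable_snd measurable_fst).
Qed.

Lemma tail_step m x : (P [set w | (x < L m.+1 w)%R] = \int[dl]_v \int[e]_a exceed m x v a)%E.
Proof.
have mphi : measurable_fun setT (fun z : R => (\1_(`]x, +oo[%classic) z)%:E : \bar R).
  by apply/measurable_EFinP; exact: measurable_indic.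
have := lindley_step_swap HM bV Vdl he m mphi (fun z => _).
rewrite (_ : (\int[P]_w _)%E = P [set w | x < L m.+1 w]); last first.
  rewrite -[X in _ = P X]setIT -integral_indic//; last exact: measurable_tail.
  by apply: eq_integral => w _; rewrite !indicE; congr (_%:R)%:E; congr nat_of_bool;
    apply/idP/idP; rewrite !inE/= in_itv/= andbT.
move=> ->; last by move=> z; rewrite lee_fin.
by apply: eq_integral => v _; apply: eq_integral => a _; rewrite exceedE.
Qed.

(** It suffices that the previous sojourn exceeds [x - v + a]. The assumed bound at that level is
    averaged over [a], and the Laplace transform of the interarrival time gives
    [lam / (lam + th)]. *)
Lemma exceed_ge (eps x v : R) m : 0 <= eps -> v <= x ->
  (forall y, 0 <= y -> expR (- (th * y)) <= fine (P [set w | (y < L m w)%R]) + eps) ->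
  ((lam / (lam + th) * expR (- (th * (x - v))))%:E <= \int[e]_a exceed m x v a + eps%:E)%E.
Proof.
move=> eps0 vx IH.
have mI : measurable_fun setT (exceed m x v).
  exact: (measurable_fun_pair2 v (measurable_exceed m x)).
have I0 a : (0 <= exceed m x v a)%E by rewrite /exceed measure_ge0.
rewrite (_ : eps%:E = \int[e]_a cst eps%:E a)%E; last first.
  by rewrite integral_cst// [X in (_ * X)%E](@probability_setT _ _ _ e) mule1.
rewrite -ge0_integralD//.
rewrite (exp_integral_itv he); last 2 first.
- exact: emeasurable_funD.
- by move=> a; rewrite adde_ge0// lee_fin.
have -> : ((lam / (lam + th) * expR (- (th * (x - v))))%:E =
  \int[e]_(a in `[0%R, +oo[) ((expR (- (th * (x - v))))%:E * (expR (- (th * a)))%:E))%E.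
  rewrite ge0_integralZl//; last first.
    apply: measurable_funTS; apply/measurable_EFinP; apply: measurableT_comp => //.
    by apply: measurableT_comp => //; exact: measurable_funM.
  by rewrite (exp_laplace lam0 th0 he) -EFinM mulrC.
apply: ge0_le_integral => //.
- apply: measurable_funTS; apply: measurable_funeM; apply/measurable_EFinP.
  apply: measurableT_comp => //; apply: measurableT_comp => //; exact: measurable_funM.
- by apply: measurable_funTS; exact: emeasurable_funD.
move=> a; rewrite /= in_itv/= andbT => a0.
have y0 : 0 <= x - v + a by rewrite addr_ge0// subr_ge0.
have mt : measurable [set w | x - v + a < L m w] by exact: measurable_tail.
apply: (@le_trans _ _ ((fine (P [set w | (x - v + a < L m w)%R]) + eps)%:E)).
  rewrite -EFinM lee_fin -expRD.
  rewrite (_ : _ + _ = - (th * (x - v + a))); first exact: IH.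
  by ring.
rewrite EFinD leeD2r// fineK ?fin_num_measure//.
apply: le_measure; rewrite ?inE//; first exact: measurable_exceed_set.
move=> w /= h; have : x - v < L m w - a by rewrite ltrBrDr.
by rewrite ltrBlDr => /lt_le_trans; apply; rewrite lerD2r le_max lexx orbT.
Qed.

Lemma exceed_late m x v : x < v -> (\int[e]_a exceed m x v a = 1)%E.
Proof.
move=> xv; rewrite (eq_integral (cst 1%E)); last first.
  move=> a _; rewrite /exceed (_ : mkset _ = setT) ?probability_setT//.
  apply/seteqP; split => // w _ /=; apply: (lt_le_trans xv).
  by rewrite lerDr le_max lexx.
by rewrite integral_cst// [X in (_ * X)%E](@probability_setT _ _ _ e) mule1.
Qed.

(* The limit exp(-th x), th = nu - lam, is the fixed point of the map sending
   the tail of one sojourn time to the tail of the next; the error of the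
   approximation contracts by 1 - exp(-nu X) on [0, X]. *)
Lemma lindley_tail_ge X m x : 0 <= X -> 0 <= x ->
  expR (- (th * x)) <= fine (P [set w | x < L m w]) +
    (expR (- (th * X)) + (1 - expR (- (nu * X))) ^+ m).
Proof.
move=> X0; set q := 1 - expR (- (nu * X)); set b := expR (- (th * X)).
have q0 : 0 <= q by rewrite subr_ge0 -expR0 ler_expR oppr_le0 mulr_ge0// ltW.
have b0 : 0 <= b by exact: expR_ge0.
elim: m x => [|m IH] x x0.
  rewrite expr0; apply: (@le_trans _ _ 1).
    by rewrite -expR0 ler_expR oppr_le0 mulr_ge0// ltW.
  by rewrite addrA lerDr addr_ge0// fine_ge0.
set Q := fine _.
have Q0 : 0 <= Q by rewrite fine_ge0.
(* Beyond [X] the error term [b] alone dominates [expR (- (th * x))]. *)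
have [xX|Xx] := leP x X; last first.
  apply: (@le_trans _ _ b).
    by rewrite ler_expR lerN2 ler_pM2l// ltW.
  by rewrite addrCA lerDl addr_ge0// exprn_ge0.
set eps := b + q ^+ m in IH.
have eps0 : 0 <= eps by rewrite addr_ge0// exprn_ge0.
set E := expR (- (nu * x)); set D := expR (- (th * x)).
have dlx : dl `[0, x]%classic = (1 - E)%:E.
  by rewrite (is_exp_unique hdl (exp_dist_ray nu0))// exp_dist_itv0c.
have mg : measurable_fun setT (fun v => \int[e]_a exceed m x v a)%E.
  apply: (@measurable_fun_fubini_tonelli_F _ _ _ _ R e (fun va => exceed m x va.1 va.2)).
    exact: measurable_exceed.
  by move=> z; rewrite /exceed measure_ge0.
have g0 v : (0 <= \int[e]_a exceed m x v a)%E.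
  by apply: integral_ge0 => a _; rewrite /exceed measure_ge0.
have nuth : 0 < nu - th by rewrite subr_gt0.
(* Services longer than [x] contribute [E]; shorter ones are bounded by [exceed_ge], whose integral
   is a tilted one. *)
have key : E + lam / (lam + th) * D * (nu / (nu - th) * (1 - expR (- ((nu - th) * x)))) <=
    Q + eps * (1 - E).
  rewrite -lee_fin EFinD [X in (_ <= X)%E]EFinD.
  have -> : Q%:E = (\int[dl]_v \int[e]_a exceed m x v a)%E.
    by rewrite -tail_step /Q fineK// fin_num_measure//; exact: measurable_tail.
  rewrite (exp_integral_split hdl mg g0 x0).
  rewrite [X in (_ <= _ + X + _)%E](_ : _ = E%:E); last first.
    rewrite (eq_integral (cst 1%E)) ?integral_cst//= ?mul1e ?hdl//.
    by move=> v; rewrite inE/= in_itv/= andbT; exact: exceed_late.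
  rewrite [X in (_ <= X)%E]addeAC [X in (_ <= X)%E]addeC leeD2l//.
  rewrite [(eps * (1 - E))%:E]EFinM -dlx -integral_cst// -ge0_integralD//; last exact: measurable_funTS.
  have mexp : measurable_fun setT (fun v : R => (expR (th * v))%:E).
    apply/measurable_EFinP.
    by apply: (@measurableT_comp _ _ _ _ _ _ (@expR R)) => //; exact: measurable_funM.
  rewrite EFinM -(exp_tilt0c nu0 thnu x0 hdl) -ge0_integralZl//; last 2 first.
  - exact: measurable_funTS.
  - by rewrite lee_fin mulr_ge0 ?expR_ge0// divr_ge0// ltW// addr_gt0.
  apply: ge0_le_integral => //.
  - move=> v _; rewrite -EFinM lee_fin mulr_ge0 ?expR_ge0// mulr_ge0 ?expR_ge0//.
    by rewrite divr_ge0// ltW// addr_gt0.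
  - by apply: measurable_funTS; exact: measurable_funeM.
  - by apply: measurable_funTS; exact: emeasurable_funD.
  move=> v; rewrite /= in_itv/= => /andP[v0 vx].
  apply: le_trans (exceed_ge eps0 vx IH).
  rewrite -EFinM lee_fin -(mulrA (lam / (lam + th))) /D -expRD.
  by rewrite (_ : - (th * x) + th * v = - (th * (x - v)))//; ring.
have DE : E = D * expR (- ((nu - th) * x)) by rewrite /D -expRD; congr expR; ring.
have ED : E <= D by rewrite ler_expR lerN2 ler_wpM2r// ltW.
have E1 : 0 <= E by exact: expR_ge0.
have Eq : 1 - E <= q by rewrite lerD2l lerN2 ler_expR lerN2 ler_pM2l.
have E1' : 0 <= 1 - E by rewrite subr_ge0 -expR0 ler_expR oppr_le0 mulr_ge0// ltW.
(* Here [nu - lam <= th] enters: the numerator exceeds the denominator by [th * (th - (nu - lam))].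
   The coefficient is 1 when [th = nu - lam]. *)
have coef : 1 <= lam / (lam + th) * (nu / (nu - th)).
  have lt0 : 0 < lam + th by rewrite addr_gt0.
  rewrite (_ : _ * _ = lam * nu / ((lam + th) * (nu - th))); last first.
    by field; rewrite !gt_eqF.
  rewrite ler_pdivlMr ?mulr_gt0// mul1r.
  rewrite -subr_ge0 (_ : _ - _ = th * (th - (nu - lam))); last by ring.
  by rewrite mulr_ge0 ?subr_ge0// ltW.
have key2 : D <= Q + eps * (1 - E).
  apply: le_trans key.
  rewrite (_ : _ + _ = E + lam / (lam + th) * (nu / (nu - th)) * (D - E)); last first.
    by rewrite DE; ring.
  rewrite -lerBlDl; apply: ler_peMl => //; by rewrite subr_ge0.
(* In [(b + q ^+ m) * (1 - E)] the factor is bounded by 1 on [b] and by [q] on [q ^+ m], using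
   [x <= X]. *)
apply: (le_trans key2); rewrite lerD2l /eps mulrDl lerD//.
  by rewrite ler_piMr// lerBlDr lerDl.
by rewrite exprSr ler_wpM2l// exprn_ge0.
Qed.

End LowerBound.

Lemma big_max_enum (R : realType) (n r : nat) (A : {set 'I_n}) (cA : #|A| = r)
    (F : 'I_n -> R) (x0 : R) :
  \big[Num.max/x0]_(s in A) F s = \big[Num.max/x0]_(j < r) F (enum_val (cast_ord (esym cA) j)).
Proof.
subst r; rewrite -big_enum /=.
have -> : enum A = [seq enum_val j | j <- enum 'I_#|A|].
  (* Comparing lists by [nth] needs a default element of ['I_n], so the empty set is treated
     apart. *)
  case: (set_0Vmem A) => [A0|[x xA]].
    have cA : #|A| = 0%N by rewrite A0 cards0.
    transitivity (Nil 'I_n); first by apply: size0nil; rewrite -cardE.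
    by apply/esym/size0nil; rewrite size_map -cardE card_ord.
  apply: (@eq_from_nth _ x); first by rewrite size_map -!cardE card_ord.
  move=> j jA; rewrite -cardE in jA.
  have jA' : (j < size (enum 'I_#|A|))%N by rewrite -cardE card_ord.
  rewrite (nth_map (Ordinal jA))// (enum_val_nth x); congr nth.
  by rewrite nth_enum_ord.
by rewrite big_map big_enum; apply: eq_bigr => j _; rewrite cast_ord_id.
Qed.

Lemma total_probability (R : realType) (d : measure_display) (T : measurableType d)
    (P : probability T R) (k : nat) (o : T -> 'I_k) (E : 'I_k -> set T) :
  (forall B : set 'I_k, measurable (o @^-1` B)) -> (forall i, measurable (E i)) ->
  P [set w | E (o w) w] = (\sum_(i < k) P ([set w | o w = i] `&` E i))%E.
Proof.
move=> mo mE.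
have mF i : measurable ([set w | o w = i] `&` E i).
  by apply: measurableI => //; exact: (mo [set i]).
rewrite -measure_semi_additive_ord//.
- congr (P _); apply/seteqP; split => w.
    by move=> Ew; rewrite -bigcup_seq; exists (o w); rewrite /= ?mem_index_enum.
  by rewrite -bigcup_seq => -[i _ /= [<-]].
- by apply/trivIsetP => i j _ _ ij; rewrite -subset0 => w /= [[-> _] [ji _]]; rewrite ji eqxx in ij.
- by apply: bigsetU_measurable.
Qed.

(** * The law of the split-merge duration is the same for all objects *)

Section Duration.
Context (R : realType) (k n r t : nat).
Variables (sys : 'I_k -> 'I_n) (rec : 'I_k -> 'I_t -> {set 'I_n}).
Hypotheses (recr : forall i g, #|rec i g| = r) (sys_rec : forall i g, sys i \notin rec i g)
  (rec_disj : forall i (g g' : 'I_t), g != g' -> forall s, s \in rec i g -> s \notin rec i g').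

(** Roles shared by all objects: [None] is the systematic server and [Some (g, j)] the [j]-th server
    of group [g]. *)
Let slot : finType := option ('I_t * 'I_r).

Definition slot_server i (x : slot) : 'I_n :=
  if x is Some gj then enum_val (cast_ord (esym (recr i gj.1)) gj.2) else sys i.

Lemma slot_server_inj i : injective (slot_server i).
Proof.
have mem gj : slot_server i (Some gj) \in rec i gj.1 by exact: enum_valP.
move=> [[g j]|] [[g' j']|] //= e.
- have gg : g = g'.
    apply/eqP; apply: contraT => gg; have := rec_disj gg (mem (g, j)).
    by rewrite /= e (mem (g', j')).
  by subst g'; move/enum_val_inj: e => /cast_ord_inj ->.
- by have := mem (g, j); rewrite /= e (negbTE (sys_rec _ _)).
- by have := mem (g', j'); rewrite /= -e (negbTE (sys_rec _ _)).
Qed.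

Definition used i (l : 'I_#|slot|) : 'I_n := slot_server i (enum_val l).

Lemma used_inj i : injective (used i).
Proof. by move=> l l' /slot_server_inj/enum_val_inj. Qed.

Definition tuple_duration (u : #|slot|.-tuple R) : R :=
  \big[Num.min/tnth u (enum_rank (None : slot))]_(g < t)
    \big[Num.max/0]_(j < r) tnth u (enum_rank (Some (g, j) : slot)).

Lemma durationE i (S : 'I_n -> R) :
  duration sys rec i S = tuple_duration [tuple S (used i l) | l < #|slot|].
Proof.
rewrite /duration /fj_depart /tuple_duration tnth_mktuple /used enum_rankK /= maxxx add0r.
apply: eq_bigr => g _; rewrite (big_max_enum (recr i g)).
by apply: eq_bigr => j _; rewrite tnth_mktuple enum_rankK /= ?maxxx add0r.
Qed.

Lemma measurable_tuple_duration : measurable_fun setT tuple_duration.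
Proof.
apply: measurable_bigmin; first exact: measurable_tnth.
by move=> g; apply: measurable_bigmax => // j; exact: measurable_tnth.
Qed.

Definition duration_rv (M : fj_input R k n) m (w : fji_T M) : R :=
  duration sys rec (fji_O M m w) (fun s => fji_S M m s w).

Lemma duration_block M m :
  measurable_fun setT (@duration_rv M m : block M (@present n m) -> R).
Proof.
refine (@measurable_case _ (block M (@present n m)) k _ _
  (fji_O M m : block M (@present n m) -> 'I_k)
  (fun i (w : block M (@present n m)) => duration sys rec i (fun s => fji_S M m s w)) _ _).
  by move=> B; apply: block_O => /=.
move=> i; apply: measurable_depart => // s.
by apply: block_S => /=.
Qed.

(** For every object the duration is the same [tuple_duration] of independent exponential times on
    distinct servers. The object is independent of the services, so averaging over it leaves this
    common law. *)
Lemma duration_law (M M' : fj_input R k n) (lam lam' mu : R) (HM : fj_base M lam mu)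
    (HM' : fj_base M' lam' mu) (mu0 : 0 < mu) (j0 : 'I_k) m m' (F : set R) : measurable F ->
  fji_P M (@duration_rv M m @^-1` F) =
  fji_P M' ((fun w => duration sys rec j0 (fun s => fji_S M' m' s w)) @^-1` F).
Proof.
move=> mF.
have [_ [mO _ _ _ _]] := HM.
have mtF : measurable (tuple_duration @^-1` F).
  by rewrite -[X in measurable X]setTI; exact: measurable_tuple_duration.
pose E i : set (fji_T M) := services M (used i) m @^-1` (tuple_duration @^-1` F).
have bE (J : pred (fj_index n)) i : (forall s, J (inr (m, s))) -> measurable (E i : set (block M J)).
  move=> Jm; rewrite -[X in measurable X]setTI.
  have : measurable_fun setT (services M (used i) m : block M J -> _).
    by apply: measurable_mktuple => l; exact: block_S.
  exact.
have mE i : measurable (E i).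
  by rewrite -[X in measurable X]setTI; exact: (measurable_services HM (used i) m).
set D := fji_P M' _.
have ED i : fji_P M (E i) = D.
  rewrite /E (services_law HM HM' mu0 m m' (@used_inj i) (@used_inj j0) mtF) /D.
  by congr (fji_P M' _); apply/seteqP; split => w /=; rewrite durationE.
rewrite (_ : _ @^-1` _ = [set w | E (fji_O M m w) w]); last first.
  by apply/seteqP; split => w; rewrite /E /= /duration_rv durationE.
rewrite (total_probability _ (mO m) mE).
rewrite (eq_bigr (fun i => fji_P M [set w | fji_O M m w = i] * D)%E); last first.
  move=> i _; rewrite -(ED i).
  apply: (@blocks_indep _ _ _ _ _ _ HM (pred1 (inl (inr m) : fj_index n))
    (fun x : fj_index n => if x is inr (j, _) then j == m else false)).
  - by move=> x /= /eqP ->.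
  - by apply: (@block_O _ _ _ M _ m [set i]); rewrite /= eqxx.
  - by apply: bE => s /=.
rewrite -ge0_sume_distrl; last by move=> i _; exact: measure_ge0.
have := total_probability (fji_P M) (mO m) (fun=> measurableT).
rewrite [X in fji_P M X](_ : _ = setT); last by apply/seteqP; split.
rewrite probability_setT => /esym; under eq_bigr do rewrite setIT.
by move=> ->; rewrite mul1e.
Qed.

End Duration.

(** * Law of the minimum of [t.+1] service times *)

Section Fastest.
Context (R : realType) (k n t : nat).
Variables (sys : 'I_k -> 'I_n) (rec : 'I_k -> 'I_t -> {set 'I_n}) (i : 'I_k).
Variable c : 'I_t -> 'I_n.
Hypotheses (sys_rec : forall g, sys i \notin rec i g) (crec : forall g, c g \in rec i g)
  (rec_disj : forall (g g' : 'I_t), g != g' -> forall s, s \in rec i g -> s \notin rec i g').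

(** Index 0 is the systematic server; the others are the group representatives. *)
Definition chosen (l : 'I_t.+1) : 'I_n := oapp c (sys i) (unlift ord0 l).

Lemma chosen_inj : injective chosen.
Proof.
move=> l l'; rewrite /chosen.
case: unliftP => [g|] ->; case: unliftP => [g'|] -> //= e.
- have [->//|gg] := eqVneq g g'.
  by have := rec_disj gg (crec g); rewrite e crec.
- by have := crec g; rewrite e (negbTE (sys_rec _)).
- by have := crec g'; rewrite -e (negbTE (sys_rec _)).
Qed.

Definition fastest_rv (M : fj_input R k n) m (w : fji_T M) : R :=
  fastest sys i c (fun s => fji_S M m s w).

Lemma fastest_block M m :
  measurable_fun setT (@fastest_rv M m : block M (@present n m) -> R).
Proof.
apply: measurable_bigmin; first by apply: block_S => /=.
by move=> g; apply: block_S => /=.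
Qed.

(** The minimum exceeds [x] exactly on a box of [t.+1] rays over distinct servers, whose probability
    is a power. *)
Lemma fastest_exp (M : fj_input R k n) (lam mu : R) (HM : fj_base M lam mu) (mu0 : 0 < mu) m :
  is_exp (law (fji_P M) (block_measurable HM (@fastest_block M m))) (t.+1%:R * mu).
Proof.
move=> x x0; rewrite (lawE (fji_P M)).
rewrite (_ : _ @^-1` _ = services M chosen m @^-1` box (fun=> `]x, +oo[%classic)); last first.
  apply/seteqP; split => w /=.
    rewrite in_itv/= andbT => h l; rewrite tnth_mktuple /= in_itv/= andbT.
    rewrite /chosen; case: unliftP => [g|] _ /=; apply: (lt_le_trans h).
      exact: bigmin_le_cond.
    exact: bigmin_le_id.
  move=> h; rewrite in_itv/= andbT /fastest_rv /fastest; elim/big_ind : _.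
  - by have := h ord0; rewrite tnth_mktuple /= in_itv/= andbT /chosen unlift_none.
  - by move=> y z xy xz; rewrite lt_min xy.
  - by move=> g _; have := h (lift ord0 g); rewrite tnth_mktuple /= in_itv/= andbT /chosen liftK.
rewrite (services_box HM mu0 m chosen_inj)//.
rewrite (eq_bigr (fun=> (expR (- (mu * x)))%:E)); last by move=> l _; exact: exp_dist_ray.
have prodE (a : R) N : (\big[*%E/1%E]_(l < N) a%:E = (a ^+ N)%:E)%E.
  by elim: N => [|N IH]; rewrite ?big_ord0// big_ord_recr /= IH -EFinM exprSr.
by rewrite prodE -expRM_natl mulrN mulrA.
Qed.

End Fastest.

(** * Steady-state inequalities *)

Lemma cvg_sum_seq (R : realType) (I : Type) (s : seq I) (f : I -> nat -> R) (l : I -> R) :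
  (forall i, f i m @[m --> \oo] --> l i) ->
  \sum_(i <- s) f i m @[m --> \oo] --> \sum_(i <- s) l i.
Proof.
move=> fl; elim: s => [|i s IH].
  by under eq_fun do rewrite big_nil; rewrite big_nil; exact: cvg_cst.
by under eq_fun do rewrite big_cons; rewrite big_cons; apply: cvgD => //; exact: fl.
Qed.

Lemma cvg_ge_perturb (R : realType) (u r : nat -> R) (l c : R) :
  u m @[m --> \oo] --> l -> r m @[m --> \oo] --> (0 : R) ->
  (forall m, c <= u m + r m) -> c <= l.
Proof.
move=> ul r0 h; rewrite -[l]addr0.
apply: (ler_cvg_to (@cvg_cst _ c _ _ _) (cvgD ul r0)).
by apply: nearW => m; exact: h.
Qed.

Section Domination.
Context (R : realType) (k n r t : nat).
Variables (sys : 'I_k -> 'I_n) (rec : 'I_k -> 'I_t -> {set 'I_n}).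
Hypotheses (recr : forall i g, #|rec i g| = r) (sys_rec : forall i g, sys i \notin rec i g)
  (rec_disj : forall i (g g' : 'I_t), g != g' -> forall s, s \in rec i g -> s \notin rec i g').

(** The sample-path bound is applied inside [M]. The passage to [M'] is an equality in law of
    Lindley recursions, since durations have the same law for any popularity vector; [j0] only
    supplies a reference form of that law. *)
Lemma sm_dominates (M M' : fj_input R k n) (lam mu : R) (HM : fj_base M lam mu)
    (HM' : fj_base M' lam mu) (mu0 : 0 < mu) (j0 : 'I_k) m (x : R) :
  fine (fji_P M [set w | x < T_FJ sys rec M m w]) <=
  fine (fji_P M' [set w | x < T_SM sys rec M' m w]).
Proof.
have mFJ := measurable_tail x (measurable_T_FJ sys rec HM m).
have mSM' := measurable_tail x (measurable_T_SM sys rec HM' m).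
rewrite fine_le ?fin_num_measure//.
pose D (Q : fj_input R k n) := @duration_rv R k n t sys rec Q.
have mL (Q : fj_input R k n) (HQ : fj_base Q lam mu) :
    measurable [set w | x < lindley_rv Q (D Q) m w].
  apply: measurable_tail; apply: (measurable_lindley HQ) => j.
  exact: duration_block.
apply: (@le_trans _ _ (fji_P M [set w | x < lindley_rv M (D M) m w])).
  apply: (le_nonneg_inputs HM) => //; first exact: mL.
  move=> w [A0 S0] /= h; apply: (lt_le_trans h); rewrite /T_FJ.
  apply: (le_trans (download_le_sm sys rec (fun j => fji_O M j w) A0 S0 m)).
  by rewrite sm_downloadE.
apply: (@le_trans _ _ (fji_P M' [set w | x < lindley_rv M' (D M') m w])); last first.
  apply: (le_nonneg_inputs HM') => //; first exact: mL.
  by move=> w [A0 S0] /=; rewrite /T_SM sm_downloadE.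
have mdur : measurable_fun setT (fun w => duration sys rec j0 (fun s => fji_S M' 0 s w)).
  by apply: measurable_depart => // s; exact: (measurable_S HM').
pose dl : probability R R := law (fji_P M') mdur.
have Ddl (Q : fj_input R k n) (HQ : fj_base Q lam mu) j F : measurable F ->
    fji_P Q (D Q j @^-1` F) = dl F.
  move=> mF; rewrite (lawE (fji_P M') mdur).
  exact: (duration_law recr sys_rec rec_disj HQ HM' mu0 j0 j 0 mF).
have mphi : measurable_fun setT (fun z : R => (\1_(`]x, +oo[%classic) z)%:E : \bar R).
  by apply/measurable_EFinP; exact: measurable_indic.
have tailE (Q : fj_input R k n) (HQ : fj_base Q lam mu) :
    (\int[fji_P Q]_w (\1_(`]x, +oo[%classic) (lindley_rv Q (D Q) m w))%:E)%E =
    fji_P Q [set w | x < lindley_rv Q (D Q) m w].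
  rewrite -[X in _ = fji_P Q X]setIT -integral_indic//; last exact: mL.
  by apply: eq_integral => w _; rewrite !indicE; congr (_%:R)%:E; congr nat_of_bool;
    apply/idP/idP; rewrite !inE/= in_itv/= andbT.
rewrite -(tailE M HM) -(tailE M' HM').
have bD Q j := @duration_block R k n t sys rec Q j.
have ind0 (z : R) : (0 <= (\1_(`]x, +oo[%classic) z)%:E :> \bar R)%E by rewrite lee_fin.
by have -> := lindley_law HM HM' (bD M) (bD M') (Ddl M HM) (Ddl M' HM') m mphi ind0.
Qed.

(** The truncation level of [lindley_tail_ge] is taken to be [j]. For fixed [j] one error vanishes
    as [m] grows, and the other vanishes as [j] grows. *)
Lemma fa_tail_ge (M : fj_input R k n) (lam mu th : R) (i : 'I_k) (HM : FA_input M lam mu i)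
    (L : R -> R) (x : R) : (0 < r)%N -> 0 < lam -> 0 < mu -> 0 < th -> th < t.+1%:R * mu ->
  t.+1%:R * mu - lam <= th -> 0 <= x ->
  (fun m => fine (fji_P M [set w | x < T_FJ sys rec M m w])) @ \oo --> L x ->
  expR (- (th * x)) <= L x.
Proof.
move=> r0 lam0 mu0 th0 thnu thlam x0 TL; have [HB Oi] := HM.
set nu := t.+1%:R * mu in thnu thlam.
have nu0 : 0 < nu by exact: lt_trans thnu.
have /fin_all_exists[c crec] : forall g, exists s, s \in rec i g.
  by move=> g; apply/card_gt0P; rewrite recr.
pose V := @fastest_rv R k n t sys i c M.
have bV := @fastest_block R k n t sys i c M.
pose dl : probability R R := law (fji_P M) (block_measurable HB (bV 0%N)).
have hdl : is_exp dl nu := fastest_exp (sys_rec i) crec (@rec_disj i) HB mu0 0.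
have Vdl m F : measurable F -> fji_P M (V m @^-1` F) = dl F.
  move=> mF; rewrite -(lawE (fji_P M) (block_measurable HB (bV m))).
  exact: is_exp_unique (fastest_exp (sys_rec i) crec (@rec_disj i) HB mu0 m) hdl F mF.
have step j m : expR (- (th * x)) <= fine (fji_P M [set w | x < T_FJ sys rec M m w]) +
    (expR (- th) ^+ j + (1 - expR (- (nu * j%:R))) ^+ m).
  have := lindley_tail_ge HB bV Vdl (A_law HB 0) hdl lam0 th0 thnu thlam m (ler0n R j) x0.
  rewrite -expRM_natl mulrN [j%:R * th]mulrC => /le_trans; apply; rewrite lerD2r.
  have mT := measurable_tail x (measurable_T_FJ sys rec HB m).
  have mL := measurable_tail x (measurable_lindley HB bV m).
  rewrite fine_le ?fin_num_measure//; apply: (le_nonneg_inputs HB) => //.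
  move=> w [A0 _] /= h; apply: (lt_le_trans h).
  rewrite /T_FJ (download_thinned _ _ _ A0 _ (i := i))//.
  exact: lindley_le_thinned.
apply: (@cvg_ge_perturb _ (fun=> L x) (fun j => expR (- th) ^+ j)).
- exact: cvg_cst.
- by apply: cvg_expr; rewrite ger0_norm ?expR_ge0// -expR0 ltr_expR oppr_lt0.
move=> j; apply: (@cvg_ge_perturb _
  (fun m => fine (fji_P M [set w | x < T_FJ sys rec M m w]) + expR (- th) ^+ j)
  (fun m => (1 - expR (- (nu * j%:R))) ^+ m)).
- by apply: cvgD => //; exact: cvg_cst.
- apply: cvg_expr; rewrite ger0_norm; first by rewrite ltrBlDr ltrDl expR_gt0.
  by rewrite subr_ge0 -expR0 ler_expR oppr_le0 mulr_ge0// ltW.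
- by move=> m; rewrite -addrA; exact: step.
Qed.

Lemma fa_exponential_bound (M : fj_input R k n) (lam mu : R) (i : 'I_k) (HM : FA_input M lam mu i)
    (L : R -> R) (x : R) : (0 < r)%N -> 0 < lam -> 0 < mu -> 0 <= x ->
  steady_tail (T_FJ sys rec M) L ->
  expR (- ((t.+1%:R * mu - lam) * x)) <= L x.
Proof.
move=> r0 lam0 mu0 x0 [TL Linf]; set nu := t.+1%:R * mu.
have nu0 : 0 < nu by rewrite mulr_gt0.
have [lnu|nul] := ltP lam nu.
  apply: (fa_tail_ge HM r0 lam0 mu0) => //; first by rewrite subr_gt0.
  by rewrite ltrBlDr ltrDl.
(* When [nu <= lam], every rate [nu / j.+2] is admissible: it is below [nu] and above
   [nu - lam <= 0]. With [expR (- z) >= 1 - z] and [j] tending to infinity the tail is at least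
   1. *)
have L1 y : 0 <= y -> 1 <= L y.
  move=> y0; apply: (@cvg_ge_perturb _ (fun=> L y) (fun j => nu * y * j.+2%:R^-1)).
  - exact: cvg_cst.
  - rewrite -(mulr0 (nu * y)); apply: cvgMl_tmp.
    have h : harmonic j.+1 @[j --> \oo] --> (0 : R) by rewrite cvg_shiftS; exact: cvg_harmonic.
    exact: h.
  move=> j; have j0 : 0 < j.+2%:R :> R by rewrite ltr0n.
  have thj : 0 < nu / j.+2%:R by rewrite divr_gt0.
  have := fa_tail_ge HM r0 lam0 mu0 thj _ _ y0 (TL y).
  have -> : nu / j.+2%:R < nu by rewrite ltr_pdivrMr// ltr_pMr// ltr1n.
  have -> : nu - lam <= nu / j.+2%:R by rewrite (le_trans _ (ltW thj))// subr_le0.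
  move=> /(_ isT isT) h; rewrite -lerBlDr; apply: le_trans h.
  apply: le_trans (expR_ge1Dx _); rewrite lerD2l lerN2.
  by rewrite le_eqVlt; apply/orP; left; apply/eqP; ring.
(* Properness makes [L] smaller than 1 beyond some [b]; [Num.max 0 b + 1] is a nonnegative point
   beyond [b]. *)
exfalso; move/cvgrPdist_lt : Linf => /(_ 1 ltr01) [b [_ hb]].
have bz : b < Num.max 0 b + 1 by rewrite (@le_lt_trans _ _ (Num.max 0 b)) ?ltrDl// le_max lexx orbT.
have z0 : 0 <= Num.max 0 b + 1 by rewrite addr_ge0// le_max lexx.
have := hb _ bz; rewrite /= sub0r normrN ltNge => /negP; apply.
by rewrite (le_trans (L1 _ z0))// ler_norm.
Qed.

End Domination.

Theorem theorem2 (F : fieldType) (R : realType) (k n r t : nat)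
  (G : 'M[F]_(k, n)) (sys : 'I_k -> 'I_n) (rec : 'I_k -> 'I_t -> {set 'I_n})
  (Hr : (0 < r)%N) (Hcode : rt_availability r G sys rec)
  (lam mu : R) (p : 'I_k -> R)
  (Hlam : 0 < lam) (Hmu : 0 < mu)
  (Hp0 : forall i, 0 <= p i) (Hp1 : \sum_(i < k) p i = 1)
  (* FJ-GA with rate lam *)
  (MGA : fj_input R k n) (HGA : GA_input MGA lam mu p)
  (LGA : R -> R) (SGA : steady_tail (T_FJ sys rec MGA) LGA)
  (* FJ-FA with rate lam * p i, every request asking for f_i *)
  (MFA : 'I_k -> fj_input R k n)
  (HFA : forall i, 0 < p i -> FA_input (MFA i) (lam * p i) mu i)
  (LFA : 'I_k -> R -> R)
  (SFA : forall i, 0 < p i -> steady_tail (T_FJ sys rec (MFA i)) (LFA i))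
  (* FJ-FA with rate lam, every request asking for a fixed f_j0 *)
  (j0 : 'I_k) (MFA1 : fj_input R k n) (HFA1 : FA_input MFA1 lam mu j0)
  (LFA1 : R -> R) (SFA1 : steady_tail (T_FJ sys rec MFA1) LFA1)
  (* FJ-SM with rate lam *)
  (MSM : fj_input R k n) (HSM : GA_input MSM lam mu p)
  (LSM : R -> R) (SSM : steady_tail (T_SM sys rec MSM) LSM) :
  forall x : R, 0 <= x ->
  [/\ LGA x >= \sum_(i < k) p i * LFA i x,
      \sum_(i < k) p i * LFA i x >=
        \sum_(i < k) p i * expR (- ((t.+1%:R * mu - p i * lam) * x)),
      LGA x <= LSM x
    & LFA1 x <= LSM x].
Proof.
move=> x x0.
have [_ [_ recr sys_rec rec_disj _]] := Hcode.
have [HGAb OGA] := HGA; have [HFA1b _] := HFA1; have [HSMb _] := HSM.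
(* The systems [MFA i] are constrained only for [p i > 0]; for [p i = 0] the weighted terms
   vanish. *)
have pE i : p i = 0 \/ 0 < p i.
  by move: (Hp0 i); rewrite le_eqVlt => /predU1P[<-|]; [left|right].
have p1 i : p i <= 1 by rewrite -Hp1 (bigD1 i)//= lerDl sumr_ge0.
have upper (M : fj_input R k n) (HM : fj_base M lam mu) (L : R -> R) :
    steady_tail (T_FJ sys rec M) L -> L x <= LSM x.
  move=> [ML _]; apply: (ler_cvg_to (ML x) (SSM.1 x)); apply: nearW => m.
  exact: (sm_dominates recr sys_rec rec_disj HM HSMb Hmu j0).
split; [|apply: ler_sum => i _|exact: upper SGA|exact: upper SFA1]; last first.
  have [->|pi0] := pE i; first by rewrite !mul0r.
  rewrite ler_pM2l// [p i * lam]mulrC.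
  apply: (fa_exponential_bound recr sys_rec rec_disj (HFA _ pi0)) (SFA _ pi0) => //.
  by rewrite mulr_gt0.
pose u m := fine (fji_P MGA [set w | x < T_FJ sys rec MGA m w]).
pose v i K := fine (fji_P (MFA i) [set w | x < T_FJ sys rec (MFA i) K w]).
(* Each request is compared with the system thinned to its own object, and the events are assembled
   by total probability. *)
have uge m : \sum_(i < k) tailM sys rec i MGA x m <= u m.
  have [_ [mO _ _ _ _]] := HGAb.
  pose E i := [set w | late sys rec i x (thinned_rv MGA sys rec i m w, services MGA id m w)].
  have mE i : measurable (E i).
    rewrite -[X in measurable X]setTI.
    apply: (measurable_fun_pair (measurable_thinned sys rec i HGAb m) (measurable_services HGAb id m)) => //.
    exact: measurable_late.
  have mF i : measurable ([set w | fji_O MGA m w = i] `&` E i).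
    by apply: measurableI => //; exact: (mO m [set i]).
  have mU : measurable [set w | E (fji_O MGA m w) w].
    rewrite (_ : mkset _ = \big[setU/set0]_(i < k) ([set w | fji_O MGA m w = i] `&` E i)).
      exact: bigsetU_measurable.
    apply/seteqP; split => w.
      by move=> Ew; rewrite -bigcup_seq; exists (fji_O MGA m w); rewrite /= ?mem_index_enum.
    by rewrite -bigcup_seq => -[i _ /= [<-]].
  have mT := measurable_tail x (measurable_T_FJ sys rec HGAb m).
  rewrite -lee_fin -sumEFin.
  rewrite (eq_bigr (fun i => fji_P MGA ([set w | fji_O MGA m w = i] `&` E i))); last first.
    by move=> i _; rewrite fineK// fin_num_measure.
  rewrite -(total_probability _ (mO m) mE) /u fineK ?fin_num_measure//.
  apply: (le_nonneg_inputs HGAb) => // w [A0 _] /= h.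
  apply: lt_le_trans (download_ge_thinned sys rec _ _ A0 m).
  by move: h; rewrite /E /late /= tnth_mktupleE.
(* For fixed [K], the comparison errors tend to 0 as [m] grows because [0 <= 1 - p i / 2 < 1] when
   [p i > 0]. Only afterwards does [K] tend to infinity, so the factor [2 ^+ K] is harmless. *)
have finite K : \sum_(i < k) p i * v i K <= LGA x.
  apply: (@cvg_ge_perturb _ u (fun m => \sum_(i < k) p i * (2 ^+ K * (1 - p i / 2) ^+ m))).
  - exact: SGA.1.
  - rewrite -[X in _ --> X](_ : \sum_(i < k) 0 = 0 :> R); last by rewrite big1.
    apply: cvg_sum_seq => i; have [->|pi0] := pE i.
      by under eq_fun do rewrite mul0r; exact: cvg_cst.
    rewrite -(mulr0 (p i)); apply: cvgMl_tmp; rewrite -(mulr0 (2 ^+ K)); apply: cvgMl_tmp.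
    have := p1 i; move=> pi1; apply: cvg_expr; rewrite ger0_norm; lra.
  move=> m; apply: (@le_trans _ _ (\sum_(i < k) (tailM sys rec i MGA x m +
      p i * (2 ^+ K * (1 - p i / 2) ^+ m)))); last by rewrite big_split/= lerD2r.
  apply: ler_sum => i _; have [p0|pi0] := pE i.
    by rewrite p0 !mul0r addr0 fine_ge0.
  have [HFAb OFA] := HFA _ pi0.
  exact: (tail_compare sys rec Hlam Hmu pi0 (p1 i) HGAb HFAb).
have vcvg : \sum_(i < k) p i * v i K @[K --> \oo] --> \sum_(i < k) p i * LFA i x.
  apply: cvg_sum_seq => i; have [->|pi0] := pE i.
    by under eq_fun do rewrite mul0r; rewrite mul0r; exact: cvg_cst.
  by apply: cvgMl_tmp; exact: (SFA _ pi0).1.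
by apply: (ler_cvg_to vcvg (@cvg_cst _ (LGA x) _ _ _)); apply: nearW => K; exact: finite.
Qed.
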